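(* Let $k\le n$ be positive integers and use the neglex term order on $\mathbb F[\mathbf x_n]$. The polynomials $h_k(x_1),h_k(x_1,x_2),\dots,h_k(x_1,\dots,x_n)$ together with the Demazure characters $\kappa_{\gamma(S)^*}(\mathbf x_n)$ for all $S\subseteq[n-1]$ with $|S|=n-k+1$ form a Gröbner basis of $J_{n,k}$. When $k<n$, this Gröbner basis is minimal.
   Context: $\mathbb F$ is a field, $\mathbb F[\mathbf x_n]=\mathbb F[x_1,\dots,x_n]$, $h_d$ denotes complete homogeneous and $e_d$ elementary symmetric polynomials; $J_{n,k}$ is the ideal generated by $h_k(x_1),\dots,h_k(x_1,\dots,x_n),e_n(\mathbf x_n),\dots,e_{n-k+1}(\mathbf x_n)$. Neglex is the lexicographic term order with $x_n>\cdots>x_1$. A Gröbner basis of $I$ is a finite subset $G\subseteq I$ whose leading monomials generate the initial ideal of $I$; it is minimal if all leading coefficients are $1$ and no leading monomial of one element divides that of another. The isobaric Demazure operator is $\pi_i(f)=\frac{x_if-x_{i+1}s_i(f)}{x_i-x_{i+1}}$, where $s_i$ swaps $x_i,x_{i+1}$. For a weak composition $\gamma=(\gamma_1,\dots,\gamma_n)$ (nonnegative integers), the Demazure character $\kappa_\gamma(\mathbf x_n)$ is defined recursively: $\kappa_\gamma=x_1^{\gamma_1}\cdots x_n^{\gamma_n}$ if $\gamma$ is weakly decreasing, and $\kappa_\gamma=\pi_i(\kappa_{s_i\gamma})$ if $\gamma_i<\gamma_{i+1}$, where $s_i\gamma$ swaps the entries in positions $i,i+1$. For $S=\{s_1<\cdots<s_m\}\subseteq[n]$,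 $\gamma(S)=(\gamma_1,\dots,\gamma_n)$ with $\gamma_{s_j}=s_j-j+1$ and $\gamma_i=0$ for $i\notin S$, and $\gamma(S)^*=(\gamma_n,\dots,\gamma_1)$ is its reversal. *)

(* Defs.v *)
From HB Require Import structures.
From mathcomp Require Import all_boot all_order all_algebra all_fingroup.
From mathcomp Require Import mpoly.
From Stdlib Require Import ClassicalEpsilon.

Set Implicit Arguments.
Unset Strict Implicit.
Unset Printing Implicit Defensive.

Import GRing.Theory.
Local Open Scope ring_scope.

Section Defs.
Context (R : fieldType) (n : nat).

(* Variables: x_(j+1) of the paper is 'X_j for j : 'I_n (0-based). *)

Definition hcomp (d j : nat) : {mpoly R[n]} :=
  \sum_(m : 'X_{1..n < d.+1} |
          (mdeg m == d) && [forall i : 'I_n, (j <= i)%N ==> (m i == 0%N)])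
    'X_[(m : 'X_{1..n})].

Definition esym (d : nat) : {mpoly R[n]} := mesym n R d.

Definition in_ideal (P : {mpoly R[n]} -> Prop) (p : {mpoly R[n]}) : Prop :=
  exists s : seq ({mpoly R[n]} * {mpoly R[n]}),
    (forall x, x \in s -> P x.2) /\ p = \sum_(x <- s) x.1 * x.2.

Definition in_ideal_seq (gs : seq {mpoly R[n]}) (p : {mpoly R[n]}) : Prop :=
  in_ideal (fun g => g \in gs) p.

Definition neglex_lt (m m' : 'X_{1..n}) : bool :=
  [exists i : 'I_n, (m i < m' i)%N &&
     [forall j : 'I_n, (i < j)%N ==> (m j == m' j)]].

Definition neglex_le (m m' : 'X_{1..n}) : bool := (m == m') || neglex_lt m m'.

Definition is_LM (p : {mpoly R[n]}) (m : 'X_{1..n}) : Prop :=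
  m \in msupp p /\ forall m', m' \in msupp p -> neglex_le m' m.

Definition initial_ideal (I : {mpoly R[n]} -> Prop) : {mpoly R[n]} -> Prop :=
  in_ideal (fun q => exists f m, I f /\ f != 0 /\ is_LM f m /\ q = 'X_[m]).

Definition LM_ideal (G : seq {mpoly R[n]}) : {mpoly R[n]} -> Prop :=
  in_ideal (fun q => exists g m, g \in G /\ g != 0 /\ is_LM g m /\ q = 'X_[m]).

Definition is_groebner (I : {mpoly R[n]} -> Prop) (G : seq {mpoly R[n]}) : Prop :=
  (forall g, g \in G -> I g) /\
  (forall p, initial_ideal I p <-> LM_ideal G p).

Definition mdivides (m m' : 'X_{1..n}) : bool := [forall i : 'I_n, (m i <= m' i)%N].

Definition is_minimal_groebner (I : {mpoly R[n]} -> Prop) (G : seq {mpoly R[n]})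
  : Prop :=
  is_groebner I G /\
  (forall g, g \in G -> g != 0 /\ forall m, is_LM g m -> g@_m = 1) /\
  (forall g g' m m', g \in G -> g' \in G -> g != g' ->
       is_LM g m -> is_LM g' m' -> ~~ mdivides m m').

(* isobaric divided difference pi_i for the adjacent pair of variables
   (x_i, x_j) = (x_i, x_{i+1}): the (exact) quotient
   (x_i f - x_{i+1} s_i(f)) / (x_i - x_{i+1}) *)
Definition pi_op (i j : 'I_n) (f : {mpoly R[n]}) : {mpoly R[n]} :=
  epsilon (inhabits 0)
    (fun q => ('X_i - 'X_j) * q = 'X_i * f - 'X_j * msym (tperm i j) f).

Definition mswap (i j : 'I_n) (g : 'X_{1..n}) : 'X_{1..n} :=
  [multinom g (tperm i j k) | k < n].

Definition ascent (g : 'X_{1..n}) : option ('I_n * 'I_n) :=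
  [pick ij : 'I_n * 'I_n | (val ij.2 == (val ij.1).+1) && (g ij.1 < g ij.2)%N].

Fixpoint demazure_rec (fuel : nat) (g : 'X_{1..n}) : {mpoly R[n]} :=
  match ascent g with
  | None => 'X_[g]
  | Some ij =>
      match fuel with
      | 0 => 0
      | f.+1 => pi_op ij.1 ij.2 (demazure_rec f (mswap ij.1 ij.2 g))
      end
  end.

(* Demazure character kappa_g; each step removes one inversion, so n*n
   steps suffice to reach a weakly decreasing composition *)
Definition demazure (g : 'X_{1..n}) : {mpoly R[n]} := demazure_rec (n * n) g.

(* gamma(S) for S a subset of [n] (0-based: element i stands for i+1):
   gamma_{s_j} = s_j - j + 1, i.e. (i+1) - #{t in S | t < i} *)
Definition gammaS (A : {set 'I_n}) : 'X_{1..n} :=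
  [multinom (if i \in A then i.+1 - #|[set t in A | (t < i)%N]| else 0)%N | i < n].

Definition mrev (g : 'X_{1..n}) : 'X_{1..n} := [multinom g (rev_ord i) | i < n].

Definition J_gens (k : nat) : seq {mpoly R[n]} :=
  [seq hcomp k j | j <- iota 1 n] ++ [seq esym d | d <- iota (n - k + 1) k].

Definition admissible_sets (k : nat) : seq {set 'I_n} :=
  enum [set A : {set 'I_n} | (#|A| == n - k + 1)%N &&
                              [forall i in A, (i.+1 < n)%N]].

Definition groebner_list (k : nat) : seq {mpoly R[n]} :=
  [seq hcomp k j | j <- iota 1 n] ++
  [seq demazure (mrev (gammaS A)) | A <- admissible_sets k].

End Defs.

(* Main.v *)
Require Import Defs.
From HB Require Import structures.
From mathcomp Require Import all_boot all_order all_algebra all_fingroup.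
From mathcomp Require Import mpoly.
From mathcomp Require Import ring zify.
From Stdlib Require Import ClassicalEpsilon.

(** The nonzero parts of gamma(S)^* decrease from left to right, so its Demazure
    character is the flagged Schur determinant det(h_(lam_a - a + b)(x_1..x_(p_a))),
    with p_a the positions of the nonzero parts: each pi_i only enlarges the
    alphabet of one row.  Here lam_a - a = k - p_a, and the coefficients of
    prod_i (1 - x_i t) give a vector with last entry 1 which the matrix maps into
    J_(n,k); hence the determinant lies in J_(n,k).  Its neglex leading term is the
    diagonal one.

    For the initial ideal, let alpha_1, alpha_2, ... be distinct scalars (available
    after extending F to F(t)) and let Y be the set of points with distinct
    coordinates z_i in {alpha_1..alpha_(k+i-1)} that use all of alpha_1..alpha_k.
    The generators of J_(n,k) are top-degree parts of polynomials vanishing on Y,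
    and so are all homogeneous components of elements of J_(n,k).  Hence a neglex
    leading monomial of J_(n,k) is, as a function on Y, a combination of monomials
    that are smaller by degree, then neglex; dividing repeatedly, one can take
    these standard, that is divisible by no proposed leading monomial.  By
    induction on n, standard monomials are linearly independent as functions on Y,
    so no standard monomial is a leading monomial of J_(n,k). *)

Set Implicit Arguments.
Unset Strict Implicit.
Unset Printing Implicit Defensive.

Import Order.TTheory GRing.Theory.
Local Open Scope ring_scope.

(** * Generating series *)

Section TruncatedSeries.
Context (A : comNzRingType) (N : nat).
Implicit Types (p q : {poly A}) (x y : A) (s t : seq A).

Definition eqmodXn p q := forall d, (d < N)%N -> p`_d = q`_d.

Lemma eqmodXnM p p' q q' : eqmodXn p p' -> eqmodXn q q' -> eqmodXn (p * q) (p' * q').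
Proof.
move=> eq_p eq_q d d_lt; rewrite !coefM; apply: eq_bigr => i _.
by rewrite eq_p ?eq_q //; have := ltn_ord i; lia.
Qed.

Lemma eqmodXnMl p q q' : eqmodXn q q' -> eqmodXn (p * q) (p * q').
Proof. exact: eqmodXnM. Qed.

Lemma eqmodXnB p p' q q' : eqmodXn p p' -> eqmodXn q q' -> eqmodXn (p - q) (p' - q').
Proof. by move=> eq_p eq_q d d_lt; rewrite !coefB eq_p ?eq_q. Qed.

Definition geom x : {poly A} := \poly_(l < N) x ^+ l.

Lemma one_sub_geom x : eqmodXn ((1 - x *: 'X) * geom x) 1.
Proof.
have -> : (1 - x *: 'X) * geom x = 1 - (x *: 'X) ^+ N.
  rewrite -[RHS]opprB subrX1 -mulNr opprB /geom poly_def; congr (_ * _).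
  by apply: eq_bigr => i _; rewrite exprZn.
by move=> d d_lt; rewrite coefB exprZn coefZ coefXn ltn_eqF // mulr0 subr0.
Qed.

Lemma geom_partial_fractions x y :
  eqmodXn ((x - y)%:P * (geom x * geom y)) (x%:P * geom x - y%:P * geom y).
Proof.
have -> : (x - y)%:P * (geom x * geom y) = x%:P * geom x * ((1 - y *: 'X) * geom y) -
    y%:P * geom y * ((1 - x *: 'X) * geom x).
  by rewrite -!mul_polyC polyCB; ring.
rewrite -[X in eqmodXn _ (X - _)]mulr1 -[X in eqmodXn _ (_ - X)]mulr1.
by apply: eqmodXnB; apply: eqmodXnMl; apply: one_sub_geom.
Qed.

(* With signs: the coefficient of 'X^d is (-1)^d e_d(s). *)
Definition eseries s : {poly A} := \prod_(y <- s) (1 - y *: 'X).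
Definition hseries s : {poly A} := \prod_(y <- s) geom y.

Lemma eseries_cat s t : eseries (s ++ t) = eseries s * eseries t.
Proof. exact: big_cat. Qed.

Lemma hseries_cat s t : hseries (s ++ t) = hseries s * hseries t.
Proof. exact: big_cat. Qed.

Lemma perm_hseries s t : perm_eq s t -> hseries s = hseries t.
Proof. by move=> st; apply: perm_big. Qed.

Lemma size_eseries s : (size (eseries s) <= (size s).+1)%N.
Proof.
elim: s => [|y s IH]; first by rewrite /eseries big_nil size_polyC oner_neq0.
rewrite -cat1s eseries_cat /eseries big_seq1; apply: leq_trans (size_polyMleq _ _) _.
have : (size (1 - y *: 'X : {poly A})%R <= 2)%N.
  apply: leq_trans (size_polyD _ _) _; rewrite size_polyN geq_max size_polyC oner_neq0 /=.
  by apply: leq_trans (size_scale_leq _ _) _; rewrite size_polyX.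
by move=> size_y; have := leq_sub2r 1 (leq_add size_y IH); rewrite subn1.
Qed.

Lemma coefXnM_eseries_eq0 e s d : (e + size s < d)%N -> ('X^e * eseries s)`_d = 0.
Proof.
move=> d_gt; rewrite coefXnM; case: ifP => // _; apply: nth_default.
by apply: leq_trans (size_eseries s) _; lia.
Qed.

Lemma coef0_prod (I : Type) (r : seq I) (F : I -> {poly A}) :
  (\prod_(i <- r) F i)`_0 = \prod_(i <- r) (F i)`_0.
Proof. by elim/big_rec2: _ => [|i y p _ <-]; rewrite ?coef1 // coef0M. Qed.

Lemma eseries_coef0 s : (eseries s)`_0 = 1.
Proof.
by rewrite coef0_prod big1 // => y _; rewrite coefB coefZ coefX coef1 mulr0 subr0.
Qed.

Lemma hseries_coef0 s : (0 < N)%N -> (hseries s)`_0 = 1.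
Proof. by move=> N_gt0; rewrite coef0_prod big1 // => y _; rewrite coef_poly N_gt0. Qed.

Lemma eseries_hseries s : eqmodXn (eseries s * hseries s) 1.
Proof.
rewrite -big_split /=; elim: s => [|y s IH]; first by rewrite big_nil.
by rewrite big_cons -[X in eqmodXn _ X]mulr1; apply: eqmodXnM (one_sub_geom y) IH.
Qed.

Lemma eseries_cat_hseries s t : eqmodXn (eseries (s ++ t) * hseries s) (eseries t).
Proof.
rewrite eseries_cat mulrAC -[X in eqmodXn _ X]mul1r.
by apply: eqmodXnM => //; apply: eseries_hseries.
Qed.

Lemma eseries_hseries_cat s t : eqmodXn (eseries s * hseries (s ++ t)) (hseries t).
Proof.
rewrite hseries_cat mulrA -[X in eqmodXn _ X]mul1r.
by apply: eqmodXnM => //; apply: eseries_hseries.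
Qed.

Lemma hseries_rcons s y : hseries (rcons s y) = hseries s * geom y.
Proof. by rewrite -cats1 hseries_cat /hseries big_seq1. Qed.

Lemma hseries_rcons_coefS s y d : (d.+1 < N)%N ->
  (hseries (rcons s y))`_d.+1 = (hseries s)`_d.+1 + y * (hseries (rcons s y))`_d.
Proof.
move=> d_lt; have : eqmodXn ((1 - y *: 'X) * hseries (rcons s y)) (hseries s).
  rewrite hseries_rcons mulrCA -[X in eqmodXn _ X]mulr1.
  exact/eqmodXnMl/one_sub_geom.
by move/(_ _ d_lt) => <-; rewrite mulrBl mul1r coefB -scalerAl coefZ coefXM subrK.
Qed.

Lemma eseries_hseries_coef_eq0 s t d : uniq s -> uniq t -> {subset s <= t} ->
  (d < N)%N -> (size t < size s + d)%N -> (eseries t * hseries s)`_d = 0.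
Proof.
move=> s_uniq t_uniq s_sub d_lt size_lt.
have t_perm : perm_eq t (s ++ [seq y <- t | y \notin s]).
  apply: uniq_perm => // [|y]; last first.
    by rewrite mem_cat mem_filter; case: (boolP (y \in s)) => // /s_sub ->.
  rewrite cat_uniq s_uniq filter_uniq // andbT; apply/hasPn => y.
  by rewrite mem_filter => /andP[].
rewrite /eseries (perm_big _ t_perm) /= eseries_cat_hseries // nth_default //.
apply: leq_trans (size_eseries _) _.
by rewrite -(ltn_add2l (size s)) -size_cat -(perm_size t_perm).
Qed.

End TruncatedSeries.

Section MapSeries.
Context (A B : comNzRingType) (N : nat) (f : {rmorphism A -> B}).

Lemma map_geom x : map_poly f (geom N x) = geom N (f x).
Proof.
apply/polyP => d; rewrite coef_map /= /geom !coef_poly.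
by rewrite (fun_if f) rmorphXn rmorph0.
Qed.

Lemma map_eseries s : map_poly f (eseries s) = eseries (map f s).
Proof.
rewrite rmorph_prod /eseries big_map; apply: eq_bigr => y _.
by rewrite rmorphB rmorph1 /= linearZ /= map_polyX.
Qed.

Lemma map_hseries s : map_poly f (hseries N s) = hseries N (map f s).
Proof.
by rewrite rmorph_prod /hseries big_map; apply: eq_bigr => y _; apply: map_geom.
Qed.

End MapSeries.

Lemma coefM_revsum (A : comNzRingType) (p q : {poly A}) c d : (size p <= c.+1)%N ->
  (p * q)`_(d + c) = \sum_(l < c.+1) p`_(c - l) * q`_(d + l).
Proof.
move=> size_p; pose F i := p`_i * q`_(d + c - i).
rewrite coefM -(big_mkord xpredT F) (@big_cat_nat _ _ _ c.+1) //=; last by lia.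
rewrite [X in _ + X]big1_seq ?addr0 => [|i]; last first.
  rewrite mem_index_iota => /andP[_ /andP[c_lt _]].
  by rewrite /F nth_default ?mul0r //; apply: leq_trans c_lt.
rewrite big_nat_rev big_mkord; apply: eq_bigr => i _.
by rewrite /F add0n subSS; congr (_ * _`__); have := ltn_ord i; lia.
Qed.

Section MPoly.
Context (R : nzRingType) (n : nat).
Implicit Types (p : {mpoly R[n]}) (m u : 'X_{1..n}).

Lemma mcoeffMX_sub p m u : (p * 'X_[u])@_m = if (u <= m)%MM then p@_(m - u) else 0.
Proof.
case: ifP => [/submK mE|]; first by rewrite -[in LHS]mE addmC mcoeffMX.
move/negP => u_le; apply/memN_msupp_eq0; rewrite (perm_mem (msuppMX _ _)).
by apply/mapP => -[w _ mE]; case: u_le; rewrite mE lem_addr.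
Qed.

Lemma mpolyXU_inj : injective (fun i : 'I_n => 'X_i : {mpoly R[n]}).
Proof.
move=> i j /(congr1 (mcoeff U_(i))); rewrite !mcoeffXU eqxx.
by case: (j =P i) => // _ /eqP; rewrite oner_eq0.
Qed.

Lemma msymXU (s : 'S_n) (i : 'I_n) : msym s 'X_i = 'X_(s i) :> {mpoly R[n]}.
Proof.
rewrite msymX; congr 'X_[_]; apply/mnmP => t.
by rewrite mnmE !mnm1E -(inj_eq (@perm_inj _ s)) permKV.
Qed.

Lemma mcoeff_pihomog d p m :
  (pihomog mdeg d p)@_m = if mdeg m == d then p@_m else 0.
Proof.
rewrite pihomogE raddf_sum big_mkcond /=; case: ifP => m_deg.
  rewrite [in RHS](mpolyE p) raddf_sum /=; apply: eq_bigr => u _; case: ifP => // u_deg.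
  by rewrite mcoeffZ mcoeffX; case: eqP => [um|]; rewrite ?mulr0 // um m_deg in u_deg *.
rewrite big1 // => u _; case: ifP => // u_deg; rewrite mcoeffZ mcoeffX.
by case: eqP => [um|]; rewrite ?mulr0 // -um u_deg in m_deg *.
Qed.

Lemma msize_leP d p : reflect (forall m, (d <= mdeg m)%N -> p@_m = 0) (msize p <= d)%N.
Proof.
apply: (iffP idP) => [p_le m dm|p0].
  by apply/memN_msupp_eq0/msize_mdeg_ge/(leq_trans p_le).
rewrite msizeE; apply/bigmax_leqP_seq => m m_supp _; rewrite ltnNge.
by apply: contraL m_supp => /p0; rewrite mcoeff_msupp => ->; rewrite eqxx.
Qed.

Lemma dhomog_msize_le d p : p \is d.-homog -> (msize p <= d.+1)%N.
Proof.
move=> p_homog; apply/msize_leP => m dm; apply: (dhomog_nemf_coeff p_homog).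
by rewrite neq_ltn dm orbT.
Qed.

Lemma msizeMX_le p m : (msize (p * 'X_[m]) <= msize p + mdeg m)%N.
Proof.
apply/msize_leP => u u_deg; rewrite mcoeffMX_sub; case: ifP => // mu.
move/msize_leP: (leqnn (msize p)); apply.
by rewrite -(leq_add2r (mdeg m)) -mdegD submK.
Qed.

End MPoly.

Section Variables.
Context (R : fieldType) (n : nat).
Local Notation A := {mpoly R[n]}.
Implicit Types m : 'X_{1..n}.

Definition mvars : seq A := [seq 'X_i | i <- enum 'I_n].

Lemma size_mvars : size mvars = n.
Proof. by rewrite size_map size_enum_ord. Qed.

Lemma size_take_mvars j : (j <= n)%N -> size (take j mvars) = j.
Proof. by rewrite -[X in (_ <= X)%N]size_mvars; apply: size_takel. Qed.

Lemma take_mvars q : take q mvars = [seq 'X_i | i <- take q (enum 'I_n)].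
Proof. by rewrite map_take. Qed.

Lemma take_mvarsS (j : 'I_n) : take j.+1 mvars = rcons (take j mvars) 'X_j.
Proof.
rewrite (take_nth 0) ?size_mvars //.
by rewrite (nth_map j) ?size_enum_ord // nth_ord_enum.
Qed.

Lemma mcoeff_hcomp d j m : (hcomp R n d j)@_m =
  ((mdeg m == d) && [forall i : 'I_n, (j <= i)%N ==> (m i == 0%N)])%:R.
Proof.
rewrite /hcomp raddf_sum /=.
case: (boolP (_ && _)) => [/andP[/eqP m_deg m_out]|m_bad].
  have m_lt : (mdeg m < d.+1)%N by rewrite m_deg.
  rewrite (bigD1 (BMultinom m_lt)) /= ?m_deg ?eqxx // mcoeffX eqxx.
  rewrite big1 ?addr0 // => u /andP[_ u_neq]; rewrite mcoeffX.
  by case: eqP => // eq_um; case/eqP: u_neq; apply: val_inj.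
rewrite big1 // => u u_ok; rewrite mcoeffX; case: eqP => // eq_um.
by rewrite -eq_um u_ok in m_bad.
Qed.

Lemma hcomp0 j : hcomp R n 0 j = 1.
Proof.
apply/mpolyP => m; rewrite mcoeff_hcomp mcoeff1 mdeg_eq0.
case: eqP => //= ->; case: forallP => // -[] i.
by rewrite mnm0E eqxx implybT.
Qed.

Lemma hcompS0 d : hcomp R n d.+1 0 = 0.
Proof.
apply/mpolyP => m; rewrite mcoeff_hcomp mcoeff0.
case: forallP => [m0|]; last by rewrite andbF.
by rewrite andbT mdegE big1 // => i _; apply/eqP/m0.
Qed.

Lemma hcompSS d (j : 'I_n) :
  hcomp R n d.+1 j.+1 = hcomp R n d.+1 j + 'X_j * hcomp R n d j.+1.
Proof.
apply/mpolyP => m; rewrite mcoeffD mulrC mcoeffMX_sub !mcoeff_hcomp lep1mP.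
case: (posnP (m j)) => mj /=.
  rewrite addr0; congr (_ && _)%:R; apply/forallP/forallP => m0 i.
    apply/implyP; rewrite leq_eqVlt => /orP[/eqP/val_inj <-|ji]; first exact/eqP.
    exact: (implyP (m0 i)).
  by apply/implyP => ji; apply: (implyP (m0 i)); apply: ltnW.
have -> : [forall i : 'I_n, (j <= i)%N ==> (m i == 0%N)] = false.
  by apply/negP => /forallP/(_ j); rewrite leqnn; lia.
rewrite andbF add0r.
have mE : m = (m - U_(j) + U_(j))%MM by rewrite submK // lep1mP -lt0n.
rewrite [in mdeg m]mE mdegD mdeg1 addn1 eqSS; congr (_ && _)%:R.
apply: eq_forallb => i; rewrite mnmBE mnm1E.
by case: (j =P i) => [<-|_]; rewrite ?ltnn ?subn0.
Qed.

Lemma hcompE N d j : (d < N)%N -> (j <= n)%N ->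
  hcomp R n d j = (hseries N (take j mvars))`_d.
Proof.
elim: j d => [|j IHj] d.
  by rewrite take0 /hseries big_nil coef1; case: d => [|d]; rewrite ?hcomp0 ?hcompS0.
elim: d => [|d IHd] d_lt j_lt; first by rewrite hcomp0 hseries_coef0.
rewrite (hcompSS d (Ordinal j_lt)) /= IHd ?IHj //; try exact: ltnW.
by rewrite (take_mvarsS (Ordinal j_lt)) hseries_rcons_coefS.
Qed.

Lemma eseries_mvars_coef d : (eseries mvars)`_d = (-1) ^+ d *: Defs.esym R n d.
Proof.
rewrite -mul_mpolyC rmorphXn rmorphN1 /Defs.esym mesymE mulr_sumr.
rewrite /eseries big_map big_enum.
under eq_bigr => i _ do rewrite addrC.
rewrite bigA_distr /= coef_sum (bigID (fun h : {set 'I_n} => #|h| == d)) /=.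
have termE (h : {set 'I_n}) : \prod_i (if i \in h then - ('X_i *: 'X) else 1) =
    ((-1) ^+ #|h| * 'X_[mesym1 h]) *: 'X^#|h| :> {poly A}.
  rewrite -big_mkcond /= prodrN; under eq_bigr do rewrite -mul_polyC.
  rewrite big_split /= prodr_const -rmorph_prod /= mul_polyC.
  rewrite -[RHS]mul_polyC rmorphM rmorphXn rmorphN1 /= -mulrA mul_polyC.
  congr (_ * (_ *: _)); rewrite mpolyXE_id big_mkcond /=; apply: eq_bigr => i _.
  by rewrite mnmE; case: (i \in h).
rewrite [X in _ + X]big1 ?addr0 => [|h h_card]; last first.
  by rewrite termE coefZ coefXn eq_sym (negPf h_card) mulr0.
by apply: eq_bigr => h /eqP <-; rewrite termE coefZ coefXn eqxx mulr1.
Qed.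

Lemma dhomog_hcomp d j : hcomp R n d j \is d.-homog.
Proof.
apply/dhomogP => m; rewrite mcoeff_msupp mcoeff_hcomp.
by case: (mdeg m =P d) => // _; rewrite andFb eqxx.
Qed.

End Variables.

Arguments mvars {R n}.

(** * The neglex order and leading terms *)

Lemma ltn_rev_ord (n : nat) (i j : 'I_n) : (rev_ord i < rev_ord j)%N = (j < i)%N.
Proof. by rewrite /=; have := ltn_ord i; have := ltn_ord j; lia. Qed.

Section Neglex.
Context (n : nat).
Implicit Types m : 'X_{1..n}.

Lemma mrevE m i : mrev m i = m (rev_ord i).
Proof. exact: mnmE. Qed.

Lemma mrevK : involutive (@mrev n).
Proof. by move=> m; apply/mnmP => i; rewrite !mrevE rev_ordK. Qed.

Lemma mdeg_mrev m : mdeg (mrev m) = mdeg m.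
Proof.
rewrite !mdegE (reindex_inj rev_ord_inj); apply: eq_bigr => i _.
by rewrite mrevE rev_ordK.
Qed.

Lemma neglex_ltP m m' : reflect
  (exists2 i : 'I_n, (m i < m' i)%N & forall j : 'I_n, (i < j)%N -> m j = m' j)
  (neglex_lt m m').
Proof.
apply: (iffP existsP) => [[i /andP[lt_i /forallP eq_above]]|[i lt_i eq_above]];
  exists i => //.
  by move=> j ij; apply/eqP; apply: (implyP (eq_above j)).
by rewrite lt_i; apply/forallP => j; apply/implyP => /eq_above ->.
Qed.

(* The exponents, read from the largest variable down. *)
Definition revexp m : n.-tuplelexi nat := multinom_val (mrev m).

Lemma neglex_ltE m m' : neglex_lt m m' = (revexp m < revexp m')%O.
Proof.
apply/neglex_ltP/ltxi_tuplePlt => [[i lt_i eq_above]|[i eq_below lt_i]].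
  exists (rev_ord i) => [j ji|]; rewrite -!mnm_tnth !mrevE ?rev_ordK //.
  by apply: eq_above; rewrite -ltn_rev_ord rev_ordK.
exists (rev_ord i) => [|j ij]; first by rewrite -!mrevE.
rewrite -[j]rev_ordK -(mrevE m) -(mrevE m'); apply: eq_below.
by rewrite -ltn_rev_ord rev_ordK.
Qed.

Lemma neglex_leE m m' : neglex_le m m' = (revexp m <= revexp m')%O.
Proof.
rewrite /neglex_le neglex_ltE le_eqVlt; congr (_ || _).
by rewrite -(inj_eq (inv_inj mrevK)).
Qed.

Lemma neglex_ltnn m : neglex_lt m m = false.
Proof. by rewrite neglex_ltE ltxx. Qed.

Lemma neglex_lexx m : neglex_le m m.
Proof. by rewrite neglex_leE lexx. Qed.

Lemma neglex_ltW m m' : neglex_lt m m' -> neglex_le m m'.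
Proof. by rewrite neglex_ltE neglex_leE; apply: ltW. Qed.

Lemma neglex_le_lt_trans m2 m1 m3 :
  neglex_le m1 m2 -> neglex_lt m2 m3 -> neglex_lt m1 m3.
Proof. by rewrite neglex_leE !neglex_ltE; apply: le_lt_trans. Qed.

Lemma neglex_le_anti m m' : neglex_le m m' -> neglex_le m' m -> m = m'.
Proof.
rewrite !neglex_leE => le_mm' le_m'm; apply: (inv_inj mrevK); apply: val_inj.
by apply: (@le_anti _ (n.-tuplelexi nat)); apply/andP.
Qed.

Lemma neglex_lt_add2r m m1 m2 : neglex_lt m1 m2 -> neglex_lt (m1 + m) (m2 + m).
Proof.
move=> /neglex_ltP[i lt_i eq_above]; apply/neglex_ltP; exists i => [|j ij].
  by rewrite !mnmDE ltn_add2r.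
by rewrite !mnmDE eq_above.
Qed.

Lemma neglex_lt_le_add m1 m2 m3 m4 : neglex_lt m1 m2 -> neglex_le m3 m4 ->
  neglex_lt (m1 + m3) (m2 + m4).
Proof.
move=> lt12 /orP[/eqP ->|lt34]; first exact: neglex_lt_add2r.
apply: neglex_le_lt_trans (neglex_lt_add2r m4 lt12); apply: neglex_ltW.
by rewrite ![(m1 + _)%MM]addmC neglex_lt_add2r.
Qed.

(* Degree first, then neglex: up to reversing the variables, the library's
   well-founded order on exponents. *)
Definition deg_neglex_lt m m' := (mrev m < mrev m')%O.

Lemma deg_neglex_lt_deg m m' : (mdeg m < mdeg m')%N -> deg_neglex_lt m m'.
Proof. by rewrite -[mdeg m]mdeg_mrev -[mdeg m']mdeg_mrev => /lt_mdeg_ltmc. Qed.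

Lemma deg_neglex_lt_neglex m m' :
  mdeg m = mdeg m' -> neglex_lt m m' -> deg_neglex_lt m m'.
Proof.
rewrite -[mdeg m]mdeg_mrev -[mdeg m']mdeg_mrev neglex_ltE => deg_eq lt.
by apply/(ltmcP deg_eq); move/ltxi_tuplePlt: lt.
Qed.

Lemma deg_neglex_ltnn m : deg_neglex_lt m m = false.
Proof. exact: ltxx. Qed.

Lemma deg_neglex_lt_trans m2 m1 m3 :
  deg_neglex_lt m1 m2 -> deg_neglex_lt m2 m3 -> deg_neglex_lt m1 m3.
Proof. exact: lt_trans. Qed.

Lemma deg_neglex_ind (P : 'X_{1..n} -> Prop) :
  (forall m, (forall m', deg_neglex_lt m' m -> P m') -> P m) -> forall m, P m.
Proof.
move=> IH m; rewrite -[m]mrevK; elim/(@ltmwf n): {m}(mrev m) => m IHm.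
by apply: IH => m'; rewrite /deg_neglex_lt mrevK -{2}[m']mrevK; apply: IHm.
Qed.

End Neglex.

Section Leading.
Context (R : fieldType) (n : nat).
Implicit Types (p q : {mpoly R[n]}) (m : 'X_{1..n}).

Definition supp_below p m := all (fun u => neglex_lt u m) (msupp p).

Lemma supp_belowM p q m m' : supp_below p m ->
  {in msupp q, forall u, neglex_le u m'} -> supp_below (p * q) (m + m')%MM.
Proof.
move/allP => p_lt q_le; apply/allP => u /msuppM_le/allpairsP.
case=> -[a b] /= [a_supp b_supp ->].
by apply: neglex_lt_le_add; [apply: p_lt|apply: q_le].
Qed.

Lemma supp_belowD p q m : supp_below p m -> supp_below q m -> supp_below (p + q) m.
Proof.
move=> /allP p_lt /allP q_lt; apply/allP => u /msuppD_le.
by rewrite mem_cat => /orP[/p_lt|/q_lt].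
Qed.

(* The scalar [c] may vanish, in which case [m] only bounds the support. *)
Definition lead p m (c : R) : bool := supp_below (p - c *: 'X_[m]) m.

Lemma leadP p m c :
  lead p m c <-> p@_m = c /\ {in msupp p, forall u, neglex_le u m}.
Proof.
have tailE u : (p - c *: 'X_[m])@_u = p@_u - c * (m == u)%:R.
  by rewrite mcoeffB mcoeffZ mcoeffX.
split=> [/allP p_lead|[p_m p_le]].
  have coef_m : p@_m = c.
    apply/eqP; rewrite -subr_eq0; have := p_lead m.
    by rewrite mcoeff_msupp tailE eqxx mulr1 neglex_ltnn; case: eqP => // _ /(_ isT).
  split=> // u u_supp; have [<-|ne] := eqVneq m u; first exact: neglex_lexx.
  apply/neglex_ltW/p_lead; rewrite mcoeff_msupp tailE (negPf ne) mulr0 subr0.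
  by rewrite -mcoeff_msupp.
apply/allP => u; rewrite mcoeff_msupp tailE; have [<-|ne] := eqVneq m u.
  by rewrite p_m mulr1 subrr eqxx.
by rewrite mulr0 subr0 -mcoeff_msupp => /p_le /orP[/eqP um|//]; rewrite um eqxx in ne.
Qed.

Lemma lead_is_LM p m : lead p m 1 -> is_LM p m.
Proof. by move/leadP => [p_m p_le]; split => //; rewrite mcoeff_msupp p_m oner_neq0. Qed.

Lemma is_LM_inj p m m' : is_LM p m -> is_LM p m' -> m = m'.
Proof. by move=> [m_supp m_max] [m'_supp m'_max]; apply: neglex_le_anti; auto. Qed.

Lemma lead_neq0 p m : lead p m 1 -> p != 0.
Proof.
move/leadP => [p_m _]; apply: contra_eq_neq p_m => ->.
by rewrite mcoeff0 eq_sym oner_neq0.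
Qed.

Lemma leadX m : lead 'X_[m] m 1.
Proof. by rewrite /lead /supp_below scale1r subrr msupp0. Qed.

Lemma lead0 m : lead 0 m 0.
Proof. by rewrite /lead /supp_below scale0r subrr msupp0. Qed.

Lemma leadD_below p q m c : lead p m c -> supp_below q m -> lead (p + q) m c.
Proof. by move=> p_lead q_lt; rewrite /lead addrAC; apply: supp_belowD. Qed.

Lemma leadM p q m m' c c' :
  lead p m c -> lead q m' c' -> lead (p * q) (m + m')%MM (c * c').
Proof.
move=> p_lead q_lead; have [_ q_le] := (leadP q m' c').1 q_lead.
have -> : p * q = p * q - c *: 'X_[m] * (c' *: 'X_[m']) + (c * c') *: 'X_[m + m'].
  by rewrite -scalerAl -scalerAr scalerA -mpolyXD subrK.
rewrite /lead addrK.
have -> : p * q - c *: 'X_[m] * (c' *: 'X_[m']) =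
    (p - c *: 'X_[m]) * q + (q - c' *: 'X_[m']) * (c *: 'X_[m]) by ring.
apply: supp_belowD; first exact: supp_belowM.
rewrite addmC; apply: supp_belowM => // u /msuppZ_le.
by rewrite msuppX inE => /eqP ->; apply: neglex_lexx.
Qed.

Lemma lead_prod (I : Type) (r : seq I) (F : I -> {mpoly R[n]}) (M : I -> 'X_{1..n})
    (c : I -> R) :
  (forall i, lead (F i) (M i) (c i)) ->
  lead (\prod_(i <- r) F i) (\sum_(i <- r) M i)%MM (\prod_(i <- r) c i).
Proof.
move=> F_lead; elim: r => [|i r IH].
  by rewrite !big_nil -mpolyX0; apply: leadX.
by rewrite !big_cons; apply: leadM.
Qed.

Lemma lead_hcomp d (j : 'I_n) : lead (hcomp R n d j.+1) (U_(j) *+ d)%MM 1.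
Proof.
have uE (i : 'I_n) : (U_(j) *+ d)%MM i = if i == j then d else 0%N.
  by rewrite mulmnE mnm1E eq_sym; case: eqP => _; rewrite ?mul1n.
apply/leadP; split.
  rewrite mcoeff_hcomp mdegMn mdeg1 mul1n eqxx /=.
  case: forallP => // -[] i; apply/implyP => ji.
  by rewrite uE -val_eqE (gtn_eqF ji).
move=> m; rewrite mcoeff_msupp mcoeff_hcomp.
case: (boolP (_ && _)) => [/andP[/eqP m_deg /forallP m_out] _|]; last by rewrite eqxx.
have m0 (i : 'I_n) : (j < i)%N -> m i = 0%N.
  by move=> ji; apply/eqP/(implyP (m_out i)).
have := m_deg; rewrite mdegE (bigD1 j) //=; case: (ltnP (m j) d) => mj.
  move=> _; apply/neglex_ltW/neglex_ltP; exists j => [|i ji]; first by rewrite uE eqxx.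
  by rewrite m0 // uE -val_eqE (gtn_eqF ji).
move=> m_sum; have := mj; rewrite -{1}m_sum -{2}[m j]addn0 leq_add2l leqn0 sum_nat_eq0.
move/forallP => rest0; apply/orP; left; apply/eqP/mnmP => i; rewrite uE.
case: (eqVneq i j) (rest0 i) => [-> _|ne] /=; last by move/eqP.
by apply/eqP; rewrite eqn_leq mj andbT -m_sum leq_addr.
Qed.

End Leading.

(** * Demazure characters as flagged determinants *)

Section IncreasingOrd.
Context (m n : nat) (p : 'I_m -> 'I_n).
Hypothesis p_incr : {homo p : a b / (a < b)%N}.

Lemma incr_ord_mono : {mono p : a b / (a < b)%N}.
Proof.
move=> a b; case: (ltngtP a b) => [/p_incr //|/p_incr ba|/val_inj ->]; last exact: ltnn.
by rewrite ltnNge (ltnW ba).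
Qed.

Lemma incr_ord_inj : injective p.
Proof.
by move=> a b pab; apply: val_inj; case: (ltngtP a b) => // /p_incr; rewrite pab ltnn.
Qed.

Lemma incr_ord_leqD (a b : 'I_m) : (a <= b)%N -> (p a + (b - a) <= p b)%N.
Proof.
move=> /subnKC; move: (b - a)%N => d; elim: d b => [|d IH] b ab.
  by rewrite addn0 (_ : b = a) //; apply: val_inj; rewrite /= -ab addn0.
have c_lt : (a + d < m)%N by apply: leq_ltn_trans (ltn_ord b); rewrite -ab leq_add2l.
have cb : (Ordinal c_lt < b)%N by rewrite /= -ab addnS.
by rewrite addnS; apply: leq_ltn_trans (IH (Ordinal c_lt) erefl) (p_incr cb).
Qed.

Lemma leq_incr_ord (a : 'I_m) : (a <= p a)%N.
Proof.
have m_gt0 : (0 < m)%N by apply: leq_ltn_trans (ltn_ord a).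
have := incr_ord_leqD (leq0n a : (Ordinal m_gt0 <= a)%N).
by rewrite subn0; apply: leq_trans; apply: leq_addl.
Qed.

End IncreasingOrd.

Section Placement.
Context (m n : nat).
Implicit Types (p : 'I_m -> 'I_n) (lam : 'I_m -> nat).

Definition mplace p lam : 'X_{1..n} := (\sum_a U_(p a) *+ lam a)%MM.

Lemma mplaceE p lam a : injective p -> mplace p lam (p a) = lam a.
Proof.
move=> p_inj; rewrite mnm_sumE (bigD1 a) //= big1 ?addn0 => [|b ba].
  by rewrite mulmnE mnm1E eqxx mul1n.
by rewrite mulmnE mnm1E (inj_eq p_inj) (negPf ba) mul0n.
Qed.

Lemma mplace_notin p lam i : i \notin codom p -> mplace p lam i = 0%N.
Proof.
move=> pi; rewrite mnm_sumE big1 // => a _; rewrite mulmnE mnm1E.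
by case: eqP => // pa; rewrite -pa codom_f in pi.
Qed.

Lemma mswap_mplace p lam i j : mswap i j (mplace p lam) = mplace (tperm i j \o p) lam.
Proof.
apply/mnmP => t; rewrite mnmE !mnm_sumE; apply: eq_bigr => a _.
by rewrite !mulmnE !mnm1E /= [_ == t](can2_eq (tpermK i j) (tpermK i j)).
Qed.

Lemma mpolyX_mplace (R : fieldType) p lam :
  'X_[mplace p lam] = \prod_a 'X_(p a) ^+ lam a :> {mpoly R[n]}.
Proof. by rewrite mprodXnE. Qed.

Lemma neglex_lt_mplace p lam lam' a : {homo p : a b / (a < b)%N} -> (lam a < lam' a)%N ->
  (forall b : 'I_m, (a < b)%N -> lam b = lam' b) ->
  neglex_lt (mplace p lam) (mplace p lam').
Proof.
move=> p_incr lt_a eq_above; have p_inj := incr_ord_inj p_incr.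
apply/neglex_ltP; exists (p a) => [|i ai]; first by rewrite !mplaceE.
have [/codomP[b iE]|i_out] := boolP (i \in codom p); last by rewrite !mplace_notin.
by rewrite iE !mplaceE // eq_above // -(incr_ord_mono p_incr) -iE.
Qed.

Section Ascents.
Context (p : 'I_m -> 'I_n) (lam : 'I_m -> nat).
Hypotheses (p_incr : {homo p : a b / (a < b)%N}) (lam_gt0 : forall a, (0 < lam a)%N).
Hypothesis lam_decr : forall a b : 'I_m, (a <= b)%N -> (lam b <= lam a)%N.

Lemma mplace_ascent i j : ascent (mplace p lam) = Some (i, j) ->
  exists a, [/\ p a = j, j = i.+1 :> nat & i \notin codom p].
Proof.
have p_inj := incr_ord_inj p_incr.
rewrite /ascent; case: pickP => // -[i' j'] /= /andP[/eqP ji lt_ij] [<- <-].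
have [/codomP[a jE]|j_out] := boolP (j' \in codom p); last first.
  by rewrite (mplace_notin _ j_out) in lt_ij.
exists a; split=> //; apply/codomP => -[b iE]; move: lt_ij.
rewrite iE jE !mplaceE // ltnNge lam_decr // ltnW // -(incr_ord_mono p_incr).
by rewrite -iE -jE ji.
Qed.

Lemma mplace_no_ascent : ascent (mplace p lam) = None -> forall a, p a = a :> nat.
Proof.
have p_inj := incr_ord_inj p_incr.
rewrite /ascent; case: pickP => // no_ascent _ [a a_lt] /=.
elim/ltn_ind: a a_lt => a IH a_lt; set a' := Ordinal a_lt.
apply/eqP; rewrite eqn_leq (leq_incr_ord p_incr a') andbT leqNgt; apply/negP => lt_ap.
have i_lt : ((p a').-1 < n)%N by apply: leq_ltn_trans (leq_pred _) (ltn_ord _).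
have := no_ascent (Ordinal i_lt, p a'); rewrite /= (ltn_predK lt_ap) eqxx /= mplaceE //.
rewrite mplace_notin ?lam_gt0 //; apply/codomP => -[b /(congr1 val) /= pb].
have ba : (b < a')%N by rewrite -(incr_ord_mono p_incr) -pb ltn_predL (leq_trans _ lt_ap).
have := IH b ba (ltn_ord b); rewrite (_ : Ordinal _ = b); last exact: val_inj.
rewrite -pb => bE; move: (ba : (b < a)%N).
by rewrite -bE -ltnS (ltn_predK lt_ap) ltnS leqNgt lt_ap.
Qed.

End Ascents.

Section MoveDown.
Context (p : 'I_m -> 'I_n) (i j : 'I_n) (a : 'I_m).
Hypotheses (p_incr : {homo p : a b / (a < b)%N}) (ji : j = i.+1 :> nat).
Hypotheses (pa : p a = j) (i_out : i \notin codom p).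
Local Notation p' := (tperm i j \o p).

Lemma tperm_comp_moved : p' a = i.
Proof. by rewrite /= pa tpermR. Qed.

Lemma tperm_comp_fixed b : b != a -> p' b = p b.
Proof.
move=> ba /=; rewrite tpermD // eq_sym.
  by apply: contraNneq i_out => <-; apply: codom_f.
by rewrite -pa (inj_eq (incr_ord_inj p_incr)).
Qed.

Lemma tperm_comp_incr : {homo p' : b c / (b < c)%N}.
Proof.
have p_neq b : p b != i by apply: contraNneq i_out => <-; apply: codom_f.
move=> b c bc; case: (eqVneq b a) (eqVneq c a) => [ba|ba] [ca|ca].
- by rewrite ba ca ltnn in bc.
- rewrite ba tperm_comp_moved tperm_comp_fixed //.
  by apply: ltn_trans (p_incr bc); rewrite ba pa ji.
- rewrite ca tperm_comp_moved tperm_comp_fixed //; have := p_incr bc.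
  by rewrite ca pa ji ltnS leq_eqVlt val_eqE (negPf (p_neq b)).
- by rewrite !tperm_comp_fixed // p_incr.
Qed.

Lemma sum_tperm_comp_lt : (\sum_b p' b < \sum_b p b)%N.
Proof.
rewrite (bigD1 a) //= [X in (_ < X)%N](bigD1 a) //= [tperm i j _]tperm_comp_moved pa ji.
rewrite addSn ltnS leq_add2l; apply: leq_sum => b ba.
by rewrite [tperm i j _]tperm_comp_fixed.
Qed.

End MoveDown.

End Placement.

Section DetRow.
Context (A : comNzRingType) (m : nat).

Lemma det_row_comb (a : 'I_m) (M M1 M2 : 'M[A]_m) (u v w : A) :
  row' a M1 = row' a M -> row' a M2 = row' a M ->
  u *: row a M = v *: row a M1 - w *: row a M2 ->
  u * \det M = v * \det M1 - w * \det M2.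
Proof.
move=> eq1 eq2 /rowP row_eq.
have cofactorE (M' : 'M[A]_m) c :
    row' a M' = row' a M -> cofactor M' a c = cofactor M a c.
  move/matrixP => eq_row'; rewrite /cofactor; congr (_ * \det _); apply/matrixP => b d.
  by have := eq_row' b (lift c d); rewrite !mxE.
rewrite !(expand_det_row _ a) !mulr_sumr -sumrB; apply: eq_bigr => c _.
have := row_eq c; rewrite !mxE !cofactorE // mulrA => ->.
by rewrite mulrBl !mulrA.
Qed.

End DetRow.

Section DividedDifference.
Context (R : fieldType) (n : nat).
Local Notation A := {mpoly R[n]}.

Lemma pi_opE (i j : 'I_n) (f q : A) : i != j ->
  ('X_i - 'X_j) * q = 'X_i * f - 'X_j * msym (tperm i j) f -> pi_op i j f = q.
Proof.
move=> ij qE; rewrite /pi_op; set P := fun _ => _.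
have sub_neq0 : 'X_i - 'X_j != 0 :> A by rewrite subr_eq0 (inj_eq (@mpolyXU_inj R n)).
by apply: (mulfI sub_neq0); rewrite qE; apply: (epsilon_spec _ P (ex_intro _ q qE)).
Qed.

Lemma mem_take_enum_ord (i : 'I_n) q : (i \in take q (enum 'I_n)) = (i < q)%N.
Proof. by rewrite in_take ?mem_enum // index_enum_ord. Qed.

Lemma msym_hseries_take N (i j : 'I_n) q : j = i.+1 :> nat -> q != i.+1 ->
  map_poly (msym (tperm i j)) (hseries N (take q mvars)) =
  hseries N (take q mvars : seq A).
Proof.
move=> ji q_neq; rewrite map_hseries; apply: perm_hseries.
have -> : map (msym (tperm i j)) (take q mvars) =
    [seq 'X_t | t <- map (tperm i j) (take q (enum 'I_n))] :> seq A.
  by rewrite take_mvars -!map_comp; apply: eq_map => t /=; rewrite msymXU.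
rewrite take_mvars; apply: perm_map; apply: uniq_perm => [||t].
- by rewrite (map_inj_uniq perm_inj) take_uniq ?enum_uniq.
- by rewrite take_uniq ?enum_uniq.
rewrite -[t in LHS](tpermK i j) mem_map ?mem_take_enum_ord; last exact: perm_inj.
by case: tpermP => [->|->|//]; rewrite ji; lia.
Qed.

End DividedDifference.

Section FlagDeterminant.
Context (R : fieldType) (n m : nat) (lam : 'I_m -> nat).
Local Notation A := {mpoly R[n]}.
Implicit Types (p : 'I_m -> 'I_n) (a b : 'I_m).

Definition flag_mx p : 'M[A]_m :=
  \matrix_(a, b) if (a <= lam a + b)%N then hcomp R n (lam a + b - a) (p a).+1 else 0.

Lemma flag_mxE N p a b : (lam a + b < N)%N ->
  flag_mx p a b = ('X^a * hseries N (take (p a).+1 mvars))`_(lam a + b).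
Proof.
move=> N_gt; rewrite mxE coefXnM ltnNge; case: ifP => //= _.
by rewrite -hcompE ?ltn_ord //; lia.
Qed.

Lemma msym_flag_mx (i j : 'I_n) p a b : j = i.+1 :> nat -> p a != i ->
  msym (tperm i j) (flag_mx p a b) = flag_mx p a b.
Proof.
move=> ji pa; rewrite !(flag_mxE _ (ltnSn _)) -coef_map rmorphM /= map_polyXn.
by rewrite msym_hseries_take.
Qed.

Lemma pi_op_det_flag_mx (i j : 'I_n) p a : {homo p : a b / (a < b)%N} ->
  j = i.+1 :> nat -> p a = j -> i \notin codom p ->
  pi_op i j (\det (flag_mx (tperm i j \o p))) = \det (flag_mx p).
Proof.
move=> p_incr ji pa i_out; apply: pi_opE; first by rewrite -val_eqE /= ji ltn_eqF.
have p_neq b : p b != i by apply: contraNneq i_out => <-; apply: codom_f.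
have p'E := tperm_comp_fixed p_incr pa i_out.
have lift_neq (b : 'I_m.-1) : lift a b != a by rewrite eq_sym neq_lift.
rewrite -det_map_mx; apply: (det_row_comb (a := a)); apply/matrixP => b c.
- by rewrite !mxE p'E.
- transitivity (msym (tperm i j) (flag_mx (tperm i j \o p) (lift a b) c)).
    by rewrite !mxE.
  by rewrite msym_flag_mx ?p'E // !mxE p'E.
suff rowE : ('X_i - 'X_j) * flag_mx p a c = 'X_i * flag_mx (tperm i j \o p) a c -
    'X_j * msym (tperm i j) (flag_mx (tperm i j \o p) a c) by move: rowE; rewrite !mxE.
rewrite !(flag_mxE _ (ltnSn _)); set N := (lam a + c).+1.
rewrite (tperm_comp_moved i pa) pa !take_mvarsS ji take_mvarsS -coef_map.
rewrite rmorphM /= map_polyXn !hseries_rcons rmorphM /= msym_hseries_take ?ltn_eqF //.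
rewrite map_geom /= msymXU tpermL.
set H := hseries N _; set x := mpolyX R U_(i); set y := mpolyX R U_(j).
rewrite -!coefCM -coefB.
have -> : (x - y)%:P * ('X^a * (H * geom N x * geom N y)) =
    'X^a * H * ((x - y)%:P * (geom N x * geom N y)) by ring.
have -> : x%:P * ('X^a * (H * geom N x)) - y%:P * ('X^a * (H * geom N y)) =
    'X^a * H * (x%:P * geom N x - y%:P * geom N y) by ring.
by apply: eqmodXnMl (ltnSn _); apply: geom_partial_fractions.
Qed.

Lemma flag_mx_row_comb N p a c (E : {poly A}) : (c < m)%N -> (lam a + c < N)%N ->
  (size E <= c.+1)%N ->
  \sum_(l < m | (l < c.+1)%N) flag_mx p a l * E`_(c - l) =
  ('X^a * (E * hseries N (take (p a).+1 mvars)))`_(lam a + c).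
Proof.
move=> c_lt N_gt size_E; rewrite mulrCA coefM_revsum //.
rewrite (big_ord_widen m (fun l => E`_(c - l) * ('X^a * _)`_(lam a + l))) //.
by apply: eq_bigr => l l_le; rewrite (@flag_mxE N) 1?mulrC //; lia.
Qed.

Lemma det_flag_mx_id p : (forall a, p a = a :> nat) ->
  \det (flag_mx p) = \prod_a 'X_(p a) ^+ lam a.
Proof.
(* [flag_mx p *m U] is triangular, as the coefficients of [eseries (take b mvars)]
   cancel the first b variables in every row. *)
move=> pE.
pose E b : {poly A} := eseries (take b mvars).
pose U : 'M[A]_m := \matrix_(l, b) if (l < b.+1)%N then (E b)`_(b - l) else 0.
have detU : \det U = 1.
  rewrite -det_tr det_trig.
    by rewrite big1 // => a _; rewrite !mxE ltnSn subnn eseries_coef0.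
  by apply/is_trig_mxP => a b ab; rewrite !mxE ltnS leqNgt ab.
have UE a b : (flag_mx p *m U) a b =
    ('X^a * (E b * hseries (lam a + b).+1 (take (p a).+1 mvars)))`_(lam a + b).
  rewrite -flag_mx_row_comb //; last first.
    by apply: leq_trans (size_eseries _) _; rewrite ltnS size_take_mvars // -(pE b) ltnW.
  rewrite mxE [RHS]big_mkcond; apply: eq_bigr => l _; rewrite [U _ _]mxE.
  by case: ifP; rewrite ?mulr0.
rewrite -[LHS]mulr1 -[in LHS]detU -det_mulmx det_trig; last first.
  apply/is_trig_mxP => a b ab; rewrite UE /E -(cat_take_drop (p a).+1 (take b mvars)).
  rewrite take_takel ?pE // (eqmodXnMl _ (eseries_cat_hseries _ _)) //.
  rewrite coefXnM_eseries_eq0 // size_drop size_take_mvars; first by lia.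
  by rewrite -(pE b) ltnW.
apply: eq_bigr => a _; rewrite UE take_mvarsS pE -cats1.
rewrite (eqmodXnMl _ (eseries_hseries_cat _ _)) // /hseries big_seq1.
by rewrite coefXnM ltnNge leq_addl /= addnK coef_poly ltnS leq_addr.
Qed.

End FlagDeterminant.

Section DemazureDeterminant.
Context (R : fieldType) (n m : nat) (lam : 'I_m -> nat).
Hypothesis lam_gt0 : forall a, (0 < lam a)%N.
Hypothesis lam_decr : forall a b : 'I_m, (a <= b)%N -> (lam b <= lam a)%N.

Lemma demazure_rec_no_ascent fuel (g : 'X_{1..n}) : ascent g = None ->
  demazure_rec R fuel g = 'X_[g].
Proof. by case: fuel => [|fuel] /= ->. Qed.

Lemma demazure_rec_mplace fuel (p : 'I_m -> 'I_n) : {homo p : a b / (a < b)%N} ->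
  (\sum_a p a <= fuel)%N ->
  demazure_rec R fuel (mplace p lam) = \det (flag_mx R lam p).
Proof.
have det_no_ascent f (q : 'I_m -> 'I_n) : {homo q : a b / (a < b)%N} ->
    ascent (mplace q lam) = None ->
    demazure_rec R f (mplace q lam) = \det (flag_mx R lam q).
  move=> q_incr no_asc; rewrite demazure_rec_no_ascent // mpolyX_mplace det_flag_mx_id //.
  exact: mplace_no_ascent no_asc.
elim: fuel p => [|fuel IH] p p_incr fuel_ge;
  case asc: (ascent (mplace p lam)) => [[i j]|].
2,4: exact: det_no_ascent.
  have [a [pa ji _]] := mplace_ascent p_incr lam_decr asc.
  by move: fuel_ge; rewrite (bigD1 a) //= pa ji.
have [a [pa ji i_out]] := mplace_ascent p_incr lam_decr asc.
rewrite /= asc /= mswap_mplace IH; first exact: pi_op_det_flag_mx pa i_out.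
  exact: tperm_comp_incr pa i_out.
by rewrite -ltnS; apply: leq_trans (sum_tperm_comp_lt p_incr ji pa i_out) fuel_ge.
Qed.

End DemazureDeterminant.

Lemma perm_last_moved m (s : 'S_m) : s != 1%g ->
  exists2 a, (s a < a)%N & forall b : 'I_m, (a < b)%N -> s b = b.
Proof.
move=> s_neq1; have [a0 s_a0] : exists a, s a != a.
  apply/existsP; apply: contraNT s_neq1 => /existsPn s_fix; apply/eqP/permP => a.
  by rewrite perm1; apply/eqP; have := s_fix a; rewrite negbK.
case: (@arg_maxnP _ a0 (fun a => s a != a) val s_a0) => a s_a a_max.
have s_above (b : 'I_m) : (a < b)%N -> s b = b.
  by move=> ab; apply/eqP; apply: contraLR ab => /a_max; rewrite -leqNgt.
exists a => //; rewrite ltn_neqAle s_a /= leqNgt; apply/negP => /s_above/perm_inj sa.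
by rewrite sa eqxx in s_a.
Qed.

Section LeadFlag.
Context (R : fieldType) (n m : nat) (lam : 'I_m -> nat) (p : 'I_m -> 'I_n).
Hypotheses (p_incr : {homo p : a b / (a < b)%N}) (lam_gt0 : forall a, (0 < lam a)%N).

Lemma lead_flag_mx a b : lead (flag_mx R lam p a b)
  (U_(p a) *+ (lam a + b - a))%MM (a <= lam a + b)%N%:R.
Proof. by rewrite mxE; case: ifP => _; [apply: lead_hcomp|apply: lead0]. Qed.

Lemma lead_det_flag_mx : lead (\det (flag_mx R lam p)) (mplace p lam) 1.
Proof.
have lead_term (s : 'S_m) := lead_prod (index_enum _) (fun a => lead_flag_mx a (s a)).
have below_term (s : 'S_m) : s != 1%g ->
    neglex_lt (mplace p (fun a => lam a + s a - a)%N) (mplace p lam).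
  case/perm_last_moved => a sa s_above; apply: (neglex_lt_mplace (a := a)) => // [|b ab].
    by have := lam_gt0 a; lia.
  by rewrite s_above // addnK.
rewrite /determinant (bigD1 1%g) //= odd_perm1 expr0 mul1r; apply: leadD_below.
  have := lead_term 1%g.
  rewrite (eq_bigr (fun a => U_(p a) *+ lam a)%MM) => [|a _]; last by rewrite perm1 addnK.
  by rewrite [X in lead _ _ X]big1 // => a _; rewrite perm1 leq_addl.
apply/allP => u /msupp_sum_le/flattenP[t /mapP[s]]; rewrite mem_filter.
move=> /andP[s_neq1 _] -> u_supp; apply: neglex_le_lt_trans (below_term s s_neq1).
have /leadP[_] := lead_term s; apply.
case: (odd_perm s) u_supp; rewrite ?expr1 ?expr0 ?mulN1r ?mul1r //.
by rewrite (perm_mem (msuppN _)).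
Qed.

End LeadFlag.

Section Ideal.
Context (R : fieldType) (n : nat) (P : {mpoly R[n]} -> Prop).
Local Notation I := (in_ideal P).

Lemma in_ideal0 : I 0.
Proof. by exists [::]; split=> //; rewrite big_nil. Qed.

Lemma in_ideal_gen g : P g -> I g.
Proof.
move=> Pg; exists [:: (1, g)]; split; last by rewrite big_seq1 mul1r.
by move=> y; rewrite inE => /eqP ->.
Qed.

Lemma in_idealD f g : I f -> I g -> I (f + g).
Proof.
move=> [s [sP ->]] [t [tP ->]]; exists (s ++ t); split; last by rewrite big_cat.
by move=> y; rewrite mem_cat => /orP[]; [apply: sP|apply: tP].
Qed.

Lemma in_idealMl f g : I g -> I (f * g).
Proof.
move=> [s [sP ->]]; exists [seq (f * y.1, y.2) | y <- s]; split.
  by move=> _ /mapP[y /sP yP ->].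
by rewrite big_map mulr_sumr; apply: eq_bigr => y _; rewrite mulrA.
Qed.

Lemma in_idealN g : I g -> I (- g).
Proof. by rewrite -mulN1r; apply: in_idealMl. Qed.

Lemma in_ideal_sum (J : eqType) (r : seq J) F :
  {in r, forall j, I (F j)} -> I (\sum_(j <- r) F j).
Proof. by move=> F_in; rewrite big_seq; apply: (big_ind I in_ideal0 in_idealD). Qed.

End Ideal.

Lemma in_ideal_sub (R : fieldType) (n : nat) (P Q : {mpoly R[n]} -> Prop) f :
  (forall g, P g -> in_ideal Q g) -> in_ideal P f -> in_ideal Q f.
Proof.
move=> sub_PQ [s [sP ->]]; apply: in_ideal_sum => y ys.
by apply/in_idealMl/sub_PQ/sP.
Qed.

Lemma det_flag_mx_in_ideal (R : fieldType) (n m : nat) (lam : 'I_m -> nat)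
    (p : 'I_m -> 'I_n) (P : {mpoly R[n]} -> Prop) :
  (0 < m)%N -> (forall a : 'I_m, (n + a < lam a + p a + m)%N) ->
  (forall l, (m <= l)%N -> in_ideal P (eseries mvars)`_l) ->
  in_ideal P (\det (flag_mx R lam p)).
Proof.
case: m lam p => // c lam p _ lam_gt E_in.
set E : {poly {mpoly R[n]}} := eseries mvars; set M := flag_mx R lam p.
pose v : 'cV_c.+1 := \col_l E`_(c - l).
have Mv_in a : in_ideal P ((M *m v) a ord0).
  pose H := hseries (lam a + c).+1 (take (p a).+1 (@mvars R n)).
  have -> : (M *m v) a ord0 = ('X^a * (take_poly c.+1 E * H))`_(lam a + c).
    rewrite -flag_mx_row_comb ?size_take_poly // mxE; apply: eq_big => [l|l _].
      by rewrite ltn_ord.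
    by rewrite [v _ _]mxE coef_take_poly ltnS leq_subr.
  have full0 : ('X^a * (E * H))`_(lam a + c) = 0.
    rewrite /E -[mvars in eseries mvars](cat_take_drop (p a).+1).
    rewrite (eqmodXnMl _ (eseries_cat_hseries _ _)) // coefXnM_eseries_eq0 //.
    by rewrite size_drop size_mvars; have := lam_gt a; have := ltn_ord (p a); lia.
  rewrite -[X in in_ideal P X]subr0 -[X in _ - X]full0 -coefB -mulrBr -mulrBl.
  rewrite mulrCA mulrC coefM.
  apply: in_ideal_sum => l _; apply: in_idealMl; rewrite coefB coef_take_poly.
  case: ltnP => [_|/E_in El]; first by rewrite subrr; apply: in_ideal0.
  by rewrite sub0r; apply: in_idealN.
have -> : \det M = (\adj M *m (M *m v)) ord_max ord0.
  by rewrite mulmxA mul_adj_mx mul_scalar_mx !mxE subnn eseries_coef0 mulr1.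
by rewrite mxE; apply: in_ideal_sum => a _; apply: in_idealMl.
Qed.

Section FlagShape.
Context (R : fieldType) (n k m : nat) (p : 'I_m -> 'I_n).
Hypothesis p_incr : {homo p : a b / (a < b)%N}.
Hypothesis mk : (m + k = n.+1)%N.

(* The row lengths for which the first column of [flag_mx] has degrees k - p a. *)
Definition flag_shape (a : 'I_m) : nat := (k + a - p a)%N.

Lemma flag_position_ltn a : (p a < k + a)%N.
Proof.
have a_lt := ltn_ord a.
have last_lt : (m.-1 < m)%N by lia.
have := incr_ord_leqD p_incr (_ : (a <= Ordinal last_lt)%N).
rewrite /= -ltnS prednK; last by lia.
by move/(_ a_lt); have := ltn_ord (p (Ordinal last_lt)); lia.
Qed.

Lemma flag_shape_gt0 a : (0 < flag_shape a)%N.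
Proof. by rewrite subn_gt0 flag_position_ltn. Qed.

Lemma flag_shape_ltn a : (forall b, (0 < p b)%N) -> (flag_shape a < k)%N.
Proof.
move=> p_gt0; have m_gt0 : (0 < m)%N by apply: leq_ltn_trans (ltn_ord a).
have := incr_ord_leqD p_incr (leq0n a : (Ordinal m_gt0 <= a)%N).
have := p_gt0 (Ordinal m_gt0); have := flag_position_ltn a; rewrite /flag_shape /= subn0.
by lia.
Qed.

Lemma flag_shape_decr (a b : 'I_m) : (a <= b)%N -> (flag_shape b <= flag_shape a)%N.
Proof. by move=> ab; have := incr_ord_leqD p_incr ab; rewrite /flag_shape; lia. Qed.

Lemma demazure_flag_shape :
  demazure R (mplace p flag_shape) = \det (flag_mx R flag_shape p).
Proof.
apply: demazure_rec_mplace => //; [exact: flag_shape_gt0|exact: flag_shape_decr|].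
apply: (@leq_trans (\sum_(a < m) n)%N); first by apply: leq_sum => a _; apply: ltnW.
rewrite sum_nat_const card_ord leq_mul2r; apply/orP; right.
by have := leq_card p (incr_ord_inj p_incr); rewrite !card_ord.
Qed.

Lemma lead_demazure_flag_shape :
  lead (demazure R (mplace p flag_shape)) (mplace p flag_shape) 1.
Proof. by rewrite demazure_flag_shape; apply/lead_det_flag_mx/flag_shape_gt0. Qed.

Lemma demazure_flag_shape_in_ideal : (k <= n)%N ->
  in_ideal_seq (J_gens R n k) (demazure R (mplace p flag_shape)).
Proof.
move=> k_le; rewrite demazure_flag_shape; apply: det_flag_mx_in_ideal => [|a|l l_ge].
- by lia.
- by rewrite subnK ?(ltnW (flag_position_ltn a)) //; lia.
case: (leqP l n) => l_le; last first.
  rewrite nth_default; first exact: in_ideal0.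
  by apply: leq_trans (size_eseries _) _; rewrite size_mvars.
rewrite eseries_mvars_coef -mul_mpolyC; apply/in_idealMl/in_ideal_gen.
by rewrite mem_cat; apply/orP; right; apply: map_f; rewrite mem_iota; lia.
Qed.

End FlagShape.

Lemma card_set_ltn (m q : nat) : (q <= m)%N -> #|[set i : 'I_m | (i < q)%N]| = q.
Proof.
by move=> qm; rewrite -sum1dep_card -(big_ord_widen _ (fun=> 1%N)) // sum1_card card_ord.
Qed.

Section Gamma.
Context (n : nat) (S : {set 'I_n}).

(* The positions of the nonzero parts of gamma(S)^*, in increasing order. *)
Definition gamma_pos (a : 'I_#|S|) : 'I_n := rev_ord (Order.enum_val (rev_ord a)).

Lemma ltn_enum_val (a b : 'I_#|S|) : (Order.enum_val a < Order.enum_val b)%N = (a < b)%N.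
Proof.
have := leW_mono (Order.le_enum_val (@le_total _ 'I_n) (A := mem S)) a b.
by rewrite !ltEord.
Qed.

Lemma gamma_pos_incr : {homo gamma_pos : a b / (a < b)%N}.
Proof. by move=> a b ab; rewrite !ltn_rev_ord ltn_enum_val ltn_rev_ord. Qed.

Lemma mem_codom_gamma_pos i : (i \in codom gamma_pos) = (rev_ord i \in S).
Proof.
apply/codomP/idP => [[a ->]|iS]; first by rewrite rev_ordK Order.enum_valP.
exists (rev_ord (Order.enum_rank_in iS (rev_ord i))).
by rewrite /gamma_pos rev_ordK Order.enum_rankK_in // rev_ordK.
Qed.

Lemma card_set_ltn_enum_val (a : 'I_#|S|) :
  #|[set t in S | (t < Order.enum_val a)%N]| = a.
Proof.
rewrite -[RHS](card_set_ltn (ltnW (ltn_ord a))).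
rewrite -(card_imset _ (@Order.enum_val_inj _ _ S)).
apply: eq_card => t; rewrite inE; apply/andP/imsetP => [[tS t_lt]|[b]].
  exists (Order.enum_rank_in tS t); rewrite ?Order.enum_rankK_in //.
  by rewrite inE -ltn_enum_val Order.enum_rankK_in.
by rewrite inE -ltn_enum_val => b_lt ->; rewrite Order.enum_valP.
Qed.

Lemma mrev_gammaS k : (#|S| + k = n.+1)%N ->
  mrev (gammaS S) = mplace gamma_pos (flag_shape k gamma_pos).
Proof.
move=> cardS; apply/mnmP => i; rewrite mrevE mnmE.
have [i_pos|i_pos] := boolP (i \in codom gamma_pos); last first.
  by rewrite mplace_notin // -mem_codom_gamma_pos (negPf i_pos).
rewrite -mem_codom_gamma_pos i_pos; have /codomP[a ->] := i_pos.
rewrite mplaceE; last exact/incr_ord_inj/gamma_pos_incr.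
rewrite /gamma_pos rev_ordK card_set_ltn_enum_val /flag_shape /=.
have reindexE c u e : (c + k = n.+1)%N -> (u < c)%N -> (e < n)%N ->
  (e.+1 - (c - u.+1) = k + u - (n - e.+1))%N by lia.
exact: reindexE cardS (ltn_ord a) (ltn_ord _).
Qed.

Lemma mrev_gammaS_ltn k i : (0 < k)%N -> (#|S| + k = n.+1)%N ->
  (forall t, t \in S -> (t.+1 < n)%N) -> (mrev (gammaS S) i < k)%N.
Proof.
move=> k_gt0 cardS S_lt; rewrite (mrev_gammaS cardS).
have [/codomP[a ->]|i_out] := boolP (i \in codom gamma_pos); last by rewrite mplace_notin.
rewrite mplaceE; last exact/incr_ord_inj/gamma_pos_incr.
apply: flag_shape_ltn => [|//|b]; first exact: gamma_pos_incr.
by rewrite subn_gt0; apply/S_lt/Order.enum_valP.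
Qed.

Lemma mrev_gammaS_gt0 i : (0 < mrev (gammaS S) i)%N = (rev_ord i \in S).
Proof.
rewrite mrevE mnmE; case: ifP => // iS; rewrite subn_gt0 ltnS.
rewrite -[X in (_ <= X)%N](card_set_ltn (ltnW (ltn_ord (rev_ord i)))).
by apply/subset_leq_card/subsetP => t; rewrite !inE => /andP[].
Qed.

End Gamma.

(** * Standard monomials *)

Section Standard.
Context (k : nat).

(* For exponents listed as by [revexp]; the counter [r] is the number of exponents met
   so far that did not exceed it. *)
Fixpoint std (r : nat) (e : seq nat) : bool :=
  if e is a :: e' then (a < k)%N && std (if (a <= r)%N then r.+1 else r) e'
  else (k <= r)%N.

Lemma std_ltn r e : std r e -> all (fun a => a < k)%N e.
Proof. by elim: e r => //= a e IH r /andP[-> /IH]. Qed.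

(* The selected positions are the first ones at which the exponent exceeds the counter. *)
Lemma nonstd_mask r e : all (fun a => a < k)%N e -> ~~ std r e ->
  exists b : seq bool, [/\ size b = size e, count id b = (r + size e).+1 - k &
    forall q, nth false b q -> r + q < nth 0 e q + count id (take q b)]%N.
Proof.
elim: e r => [|a e IH] r /=.
  rewrite -ltnNge => _ rk; exists [::]; split=> //=; first by lia.
  by move=> q; rewrite nth_nil.
case/andP=> ak e_lt; rewrite ak /=; case: leqP => ar.
  case/(IH _ e_lt) => b [size_b count_b b_gt].
  exists (false :: b); split=> /=; [by rewrite size_b|by lia|].
  by case=> // q /b_gt /=; lia.
case/(IH _ e_lt) => b [size_b count_b b_gt].
case: (leqP k (r + size e).+1) => k_le.
  exists (true :: b); split=> /=; [by rewrite size_b|by lia|].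
  by case=> [_|q /b_gt] /=; rewrite ?take0 /=; lia.
exists (nseq (size e).+1 false); split; first by rewrite size_nseq.
  by rewrite count_nseq /=; lia.
by move=> q; rewrite nth_nseq; case: ifP.
Qed.

End Standard.

Definition std_mnm (n k : nat) (m : 'X_{1..n}) : bool := std k 0 (revexp m).

Lemma size_codom_ord (T : Type) (n : nat) (f : 'I_n -> T) : size (codom f) = n.
Proof. by rewrite size_codom card_ord. Qed.

Section NonStandard.
Context (n : nat).
Implicit Types (m : 'X_{1..n}) (S : {set 'I_n}).

Lemma nth_revexp m (i : 'I_n) : nth 0%N (revexp m) i = m (rev_ord i).
Proof. by rewrite -mrevE (mnm_nth 0%N). Qed.

Lemma revexpE m : revexp m = rev (codom m) :> seq nat.
Proof.
apply: (@eq_from_nth _ 0%N) => [|i]; rewrite size_tuple ?size_rev ?size_codom_ord //.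
move=> i_lt; rewrite (nth_revexp m (Ordinal i_lt)) nth_rev size_codom_ord //.
set j := rev_ord _; rewrite -[(n - i.+1)%N]/(nat_of_ord j).
by rewrite (nth_map j) ?size_enum_ord // nth_ord_enum.
Qed.

Lemma all_revexp (a : pred nat) m : all a (revexp m) = [forall i, a (m i)].
Proof.
apply/all_tnthP/forallP => [a_all i|a_all i]; last by rewrite -mnm_tnth mrevE.
by have := a_all (rev_ord i); rewrite -mnm_tnth mrevE rev_ordK.
Qed.

Lemma card_below_count S q :
  #|[set t in S | (t < q)%N]| = count id (take q [seq t \in S | t <- enum 'I_n]).
Proof.
rewrite -map_take count_map -size_filter.
rewrite -(card_uniqP (filter_uniq _ (take_uniq _ (enum_uniq _)))).
by apply: eq_card => t; rewrite inE mem_filter mem_take_enum_ord.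
Qed.

Lemma admissible_setsP k S : (k <= n)%N ->
  reflect ((#|S| + k = n.+1)%N /\ forall t, t \in S -> (t.+1 < n)%N)
    (S \in admissible_sets n k).
Proof.
move=> k_le; rewrite mem_enum inE; apply: (iffP andP) => -[cardS S_lt]; split.
- by move/eqP: cardS => ->; lia.
- by move=> t; apply/implyP/(forallP S_lt).
- by apply/eqP; lia.
- by apply/forallP => t; apply/implyP/S_lt.
Qed.

Lemma mdivides_gammaS S m : (forall i, i \in S ->
    (i.+1 <= m (rev_ord i) + #|[set t in S | (t < i)%N]|)%N) ->
  mdivides (mrev (gammaS S)) m.
Proof.
move=> S_le; apply/mnm_lepP => i; rewrite mrevE mnmE; case: ifP => // /S_le.
by rewrite rev_ordK leq_subLR addnC.
Qed.

Lemma nonstd_mdivides k m : (k <= n)%N -> ~~ std_mnm k m ->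
  (exists i, (k <= m i)%N) \/
  exists2 S, S \in admissible_sets n k & mdivides (mrev (gammaS S)) m.
Proof.
move=> k_le m_nonstd.
case: (boolP [exists i, (k <= m i)%N]) => [/existsP|/existsPn m_lt]; first by left.
have m_all : all (fun a => a < k)%N (revexp m).
  by rewrite all_revexp; apply/forallP => i; rewrite ltnNge.
have [b []] := nonstd_mask m_all m_nonstd.
rewrite size_tuple add0n => size_b count_b b_gt.
pose S := [set i : 'I_n | nth false b i].
have bE : [seq t \in S | t <- enum 'I_n] = b.
  apply: (@eq_from_nth _ false); rewrite size_map size_enum_ord // => i i_lt.
  by rewrite (nth_map (Ordinal i_lt)) ?size_enum_ord // inE nth_enum_ord.
have S_le (i : 'I_n) : i \in S -> (i.+1 <= m (rev_ord i) + #|[set t in S | (t < i)%N]|)%N.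
  by rewrite inE => /b_gt; rewrite add0n nth_revexp card_below_count bE.
have cardS : #|S| = (n.+1 - k)%N.
  rewrite -count_b -[in RHS](take_size b) size_b -bE -card_below_count.
  by apply: eq_card => t; rewrite !inE ltn_ord andbT.
right; exists S; last exact: mdivides_gammaS.
apply/admissible_setsP => //; split=> [|i iS]; first by rewrite cardS; lia.
(* The exponent at the last position, were it selected, would be at least k. *)
rewrite ltn_neqAle ltn_ord andbT; apply/eqP => i_last; have := S_le i iS; rewrite i_last.
have -> : #|[set t in S | (t < i)%N]| = #|S :\ i|.
  apply: eq_card => t; rewrite !inE andbC; congr (_ && _).
  by rewrite -val_eqE /= ltn_neqAle -ltnS i_last ltn_ord andbT.
have := cardsD1 i S; rewrite iS cardS add1n; have := m_lt (rev_ord i).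
by move: (m _) #|_| => u w; rewrite -ltnNge; lia.
Qed.

End NonStandard.

Lemma size_filter_notin (T : eqType) (s t : seq T) : uniq s ->
  (size s <= size [seq y <- s | y \notin t] + size t)%N.
Proof.
move=> s_uniq; rewrite -(count_predC (mem t) s) addnC size_filter leq_add2l -size_filter.
apply: uniq_leq_size; first exact: filter_uniq.
by move=> y; rewrite mem_filter => /andP[].
Qed.

Section Independence.
Context (F : fieldType) (k : nat) (alpha : nat -> F).
Hypothesis alpha_inj : injective alpha.
Implicit Types (c : seq nat -> F) (ys : seq F).

(* The value at [ys] of the polynomial with coefficients [c], cut to exponents below k. *)
Fixpoint iter_horner c ys : F :=
  if ys is y :: ys' then (\poly_(a < k) iter_horner (fun e => c (a :: e)) ys').[y]
  else c [::].

Lemma eq_iter_horner c c' ys : (forall e, size e = size ys -> c e = c' e) ->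
  iter_horner c ys = iter_horner c' ys.
Proof.
elim: ys c c' => [|y ys IH] c c' eq_c /=; first exact: eq_c.
rewrite !horner_poly; apply: eq_bigr => a _; congr (_ * _); apply: IH => e size_e.
by apply: eq_c; rewrite /= size_e.
Qed.

Lemma iter_horner_sum (I : Type) (r : seq I) (d : I -> F) (C : I -> seq nat -> F) ys :
  iter_horner (fun e => \sum_(i <- r) d i * C i e) ys =
  \sum_(i <- r) d i * iter_horner (C i) ys.
Proof.
elim: ys C => //= y ys IH C; rewrite horner_poly.
under [LHS]eq_bigr => a _ do rewrite (IH (fun i e => C i (val a :: e))) mulr_suml.
rewrite exchange_big; apply: eq_bigr => i _; rewrite horner_poly mulr_sumr.
by apply: eq_bigr => a _; rewrite mulrA.
Qed.

Lemma iter_horner0 c ys : (forall e, size e = size ys -> c e = 0) -> iter_horner c ys = 0.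
Proof.
elim: ys c => [|y ys IH] c c0 /=; first exact: c0.
rewrite horner_poly big1 // => a _; rewrite IH ?mul0r // => e size_e.
by apply: c0; rewrite /= size_e.
Qed.

Lemma iter_horner_delta e0 ys : size e0 = size ys -> all (fun a => a < k)%N e0 ->
  iter_horner (fun e => (e == e0)%:R) ys = \prod_(z <- zip ys e0) z.1 ^+ z.2.
Proof.
elim: ys e0 => [|y ys IH] [|a e0] //=; first by rewrite big_nil.
case=> size_e0 /andP[ak e0_lt]; rewrite big_cons /= -IH // horner_poly.
rewrite (bigD1 (Ordinal ak)) //= big1 ?addr0 => [|b ba]; last first.
  rewrite iter_horner0 ?mul0r // => e _; rewrite eqseq_cons.
  by have := negPf ba; rewrite -val_eqE /= => ->.
rewrite mulrC; congr (_ * _); apply: eq_iter_horner => e _.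
by rewrite eqseq_cons eqxx.
Qed.

(* Points are listed, like exponents, from the last coordinate down. *)
Fixpoint staircase ys : bool :=
  if ys is y :: ys' then
    [&& y \in mkseq alpha (k + size ys'), y \notin ys' & staircase ys']
  else true.

Definition missed ys := [seq y <- mkseq alpha k | y \notin ys].

Lemma uniq_mkseq_alpha q : uniq (mkseq alpha q).
Proof. by rewrite map_inj_uniq ?iota_uniq. Qed.

Lemma sub_mkseq_alpha q q' : (q <= q')%N -> {subset mkseq alpha q <= mkseq alpha q'}.
Proof.
by move=> qq' _ /mapP[j + ->]; rewrite mem_iota => j_lt; rewrite map_f // mem_iota; lia.
Qed.

Lemma staircase_drop q ys : staircase ys -> staircase (drop q ys).
Proof. by elim: q ys => [|q IH] [|y ys] //= /and3P[_ _ /IH]. Qed.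

Lemma staircase_uniq ys : staircase ys -> uniq ys.
Proof. by elim: ys => //= y ys IH /and3P[_ -> /IH]. Qed.

Lemma staircase_sub ys : staircase ys -> {subset ys <= mkseq alpha (k + (size ys).-1)}.
Proof.
elim: ys => //= y ys IH /and3P[y_in _ /IH ys_sub] z.
rewrite inE => /orP[/eqP -> //|/ys_sub].
by apply: sub_mkseq_alpha; rewrite leq_add2l leq_pred.
Qed.

Lemma missed_cons y ys : missed (y :: ys) = [seq z <- missed ys | z != y].
Proof. by rewrite -filter_predI; apply: eq_filter => z; rewrite /= inE negb_or. Qed.

Lemma size_missed_cons y ys : (size (missed (y :: ys)) <= size (missed ys))%N.
Proof. by rewrite missed_cons size_filter count_size. Qed.

Lemma size_missed_cons_lt y ys : y \in missed ys ->
  (size (missed (y :: ys)) < size (missed ys))%N.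
Proof.
have missed_uniq : uniq (missed ys) by apply/filter_uniq/uniq_mkseq_alpha.
move=> y_missed; rewrite missed_cons -(rem_filter _ missed_uniq) size_rem // ltn_predL.
by case: (missed ys) y_missed.
Qed.

Definition null_on_points n r c := forall ys,
  size ys = n -> staircase ys -> (size (missed ys) <= r)%N -> iter_horner c ys = 0.

Lemma poly_iter_horner_eq0 c ys :
  \poly_(a < k) iter_horner (fun e => c (a :: e)) ys = 0 ->
  forall a, (a < k)%N -> iter_horner (fun e => c (a :: e)) ys = 0.
Proof.
move=> slice0 a ak; have := coef_poly k (fun a => iter_horner (fun e => c (a :: e)) ys) a.
by rewrite slice0 coef0 ak.
Qed.

(* A point missing at most r scalars extends in k ways, all missing at most r. *)
Lemma null_on_points_tail n r c a : null_on_points n.+1 r c -> (a < k)%N ->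
  null_on_points n r (fun e => c (a :: e)).
Proof.
move=> c_null ak ys size_ys ys_stair ys_missed; apply: poly_iter_horner_eq0 (ak).
apply: (@roots_geq_poly_eq0 _ _ [seq y <- mkseq alpha (k + n) | y \notin ys]).
- apply/allP => y; rewrite mem_filter => /andP[y_notin y_in].
  apply/eqP/(c_null (y :: ys)); rewrite /= ?size_ys ?y_notin ?y_in //.
  exact: leq_trans (size_missed_cons _ _) ys_missed.
- exact/filter_uniq/uniq_mkseq_alpha.
- apply: leq_trans (size_poly _ _) _.
  have := size_filter_notin ys (uniq_mkseq_alpha (k + n)).
  by rewrite size_mkseq size_ys leq_add2r.
Qed.

(* A point missing r + 1 scalars extends in r + 1 ways to one missing at most r. *)
Lemma null_on_points_tail_low n r c a : null_on_points n.+1 r c ->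
  (forall b e, (r < b)%N -> size e = n -> c (b :: e) = 0) -> (a < k)%N ->
  null_on_points n r.+1 (fun e => c (a :: e)).
Proof.
move=> c_null c_high ak ys size_ys ys_stair.
rewrite leq_eqVlt => /predU1P[ys_missed|ys_lt]; last first.
  exact: (null_on_points_tail c_null ak) ys_lt.
apply: poly_iter_horner_eq0 (ak); apply: (@roots_geq_poly_eq0 _ _ (missed ys)).
- apply/allP => y y_missed; apply/eqP/(c_null (y :: ys)) => /=; first by rewrite size_ys.
    move: (y_missed); rewrite mem_filter => /andP[-> y_in]; rewrite ys_stair !andbT.
    exact: (sub_mkseq_alpha (leq_addr _ _)) y_in.
  by rewrite -ltnS -ys_missed size_missed_cons_lt.
- exact/filter_uniq/uniq_mkseq_alpha.
- rewrite ys_missed; apply/leq_sizeP => b rb; rewrite coef_poly; case: ifP => // _.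
  by apply: iter_horner0 => e; rewrite size_ys; apply: c_high.
Qed.

Lemma std_coef_eq0 n r c : (forall e, size e = n -> ~~ std k r e -> c e = 0) ->
  null_on_points n r c -> forall e, size e = n -> c e = 0.
Proof.
elim: n r c => [|n IH] r c c_std c_null e.
  move/size0nil => ->; case: (leqP k r) => kr; last by apply: c_std; rewrite //= -ltnNge.
  apply: (c_null [::]) => //; apply: leq_trans kr; rewrite size_filter.
  by apply: leq_trans (count_size _ _) _; rewrite size_mkseq.
have c_high b e' : (r < b)%N -> size e' = n -> c (b :: e') = 0.
  move=> rb size_e'; case: (ltnP b k) => bk; last first.
    by apply: c_std; rewrite /= ?size_e' // ltnNge bk.
  apply: (IH r (fun e => c (b :: e))) => // [e1 size_e1 e1_std|].
    by apply: c_std; rewrite /= ?size_e1 // bk leqNgt rb.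
  exact: null_on_points_tail.
case: e => // a e [size_e]; case: (leqP a r) => ar; last exact: c_high.
case: (ltnP a k) => ak; last by apply: c_std; rewrite /= ?size_e // ltnNge ak.
apply: (IH r.+1 (fun e => c (a :: e))) => // [e1 size_e1 e1_std|].
  by apply: c_std; rewrite /= ?size_e1 // ak ar.
exact: null_on_points_tail_low.
Qed.

Section Multivariate.
Context (n : nat).

Definition mnm_of_seq (e : seq nat) : 'X_{1..n} := mrev [multinom nth 0%N e i | i < n].

Lemma revexpK m : mnm_of_seq (revexp m) = m.
Proof. by apply/mnmP => i; rewrite mrevE mnmE nth_revexp rev_ordK. Qed.

Lemma mnm_of_seqK e : size e = n -> revexp (mnm_of_seq e) = e :> seq nat.
Proof.
move=> size_e; apply: (@eq_from_nth _ 0%N) => [|i]; rewrite size_tuple ?size_e // => i_lt.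
by rewrite (nth_revexp _ (Ordinal i_lt)) mrevE rev_ordK mnmE.
Qed.

Lemma meval_iter_horner (p : {mpoly F[n]}) (v : 'I_n -> F) :
  (forall m, m \in msupp p -> forall i, (m i < k)%N) ->
  p.@[v] = iter_horner (fun e => p@_(mnm_of_seq e)) (rev (codom v)).
Proof.
move=> p_lt; pose delta (m : 'X_{1..n}) (e : seq nat) : F := (e == revexp m)%:R.
have size_ys : size (rev (codom v)) = n by rewrite size_rev size_codom_ord.
have coefE e : size e = size (rev (codom v)) ->
    p@_(mnm_of_seq e) = \sum_(m <- msupp p) p@_m * delta m e.
  rewrite size_ys => size_e; rewrite {1}[p]mpolyE raddf_sum /=.
  apply: eq_bigr => m _; rewrite mcoeffZ mcoeffX /delta; congr (_ * (nat_of_bool _)%:R).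
  by apply/eqP/eqP => ->; rewrite ?mnm_of_seqK ?revexpK.
rewrite (eq_iter_horner coefE) iter_horner_sum mevalE big_seq [RHS]big_seq.
apply: eq_bigr => m m_supp; congr (_ * _).
rewrite iter_horner_delta ?size_ys ?size_tuple //; last first.
  by rewrite all_revexp; apply/forallP => i; apply: p_lt.
rewrite revexpE -rev_zip ?size_codom // (perm_big _ (permEl (perm_rev _))) /=.
by rewrite zip_map big_map big_enum.
Qed.

End Multivariate.
End Independence.

(** * Deforming an ideal to a set of points *)

Section Deformation.
Context (F : fieldType) (n : nat) (Y : ('I_n -> F) -> Prop).
Implicit Types (f g p q s : {mpoly F[n]}) (m u : 'X_{1..n}).

Definition vanishes p := forall v, Y v -> p.@[v] = 0.

Lemma vanishes0 : vanishes 0.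
Proof. by move=> v _; rewrite meval0. Qed.

Lemma vanishesD p q : vanishes p -> vanishes q -> vanishes (p + q).
Proof. by move=> p0 q0 v Yv; rewrite mevalD p0 ?q0 ?addr0. Qed.

Lemma vanishesMl p q : vanishes q -> vanishes (p * q).
Proof. by move=> q0 v Yv; rewrite mevalM q0 ?mulr0. Qed.

Lemma vanishesZ a p : vanishes p -> vanishes (a *: p).
Proof. by rewrite -mul_mpolyC; apply: vanishesMl. Qed.

(* If f is homogeneous of degree d, it is the top-degree part of a polynomial
   vanishing on Y. *)
Definition deformable d f := exists2 g, vanishes g & (msize (f - g) <= d)%N.

Lemma deformable0 d : deformable d 0.
Proof. by exists 0; [exact: vanishes0|rewrite subrr msize0]. Qed.

Lemma deformableD d f f' : deformable d f -> deformable d f' -> deformable d (f + f').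
Proof.
move=> [g g0 /msize_leP g_low] [g' g'0 /msize_leP g'_low].
exists (g + g'); first exact: vanishesD.
by apply/msize_leP => m dm; rewrite opprD addrACA mcoeffD g_low ?g'_low ?addr0.
Qed.

Lemma deformableZ d a f : deformable d f -> deformable d (a *: f).
Proof.
move=> [g g0 g_low]; exists (a *: g); first exact: vanishesZ.
by rewrite -scalerBr; apply: leq_trans (mmeasureZ_le _ _ _) g_low.
Qed.

Lemma deformableMX d m f : deformable d f -> deformable (mdeg m + d) ('X_[m] * f).
Proof.
move=> [g g0 g_low]; exists ('X_[m] * g); first exact: vanishesMl.
rewrite -mulrBr mulrC addnC; apply: leq_trans (msizeMX_le _ _) _.
by rewrite leq_add2r.
Qed.

Lemma deformable_coef (a : {poly F}) (q : {poly {mpoly F[n]}}) d : a`_0 = 1 ->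
  (forall l, (l <= d)%N -> (msize q`_l <= l.+1)%N) ->
  (forall v, Y v -> (a * map_poly (meval v) q)`_d = 0) -> deformable d q`_d.
Proof.
move=> a0 q_deg aq0; exists (\sum_(l < d.+1) a`_l *: q`_(d - l)) => [v Yv|].
  rewrite raddf_sum -[RHS](aq0 v Yv) coefM; apply: eq_bigr => l _.
  by rewrite /= mevalZ coef_map.
rewrite big_ord_recl /= a0 scale1r subn0 opprD addrA subrr sub0r mmeasureN.
apply: leq_trans (msize_sum _ _ _) _; apply/bigmax_leqP => l _.
apply: leq_trans (mmeasureZ_le _ _ _) _; apply: leq_trans (q_deg _ (leq_subr _ _)) _.
by have := ltn_ord l; rewrite /bump /=; lia.
Qed.

Context (P : {mpoly F[n]} -> Prop).
Hypothesis gen_deformable : forall g, P g -> exists2 d, g \is d.-homog & deformable d g.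
Local Notation I := (in_ideal P).

Lemma ideal_deformable d f : I f -> deformable d (pihomog mdeg d f).
Proof.
case=> r [rP ->]; rewrite raddf_sum big_seq /=.
apply: (big_ind (deformable d)) => [||[a g] /rP /=].
- exact: deformable0.
- exact: deformableD.
case/gen_deformable => e g_homog g_def; rewrite [a]mpolyE mulr_suml raddf_sum /=.
apply: (big_ind (deformable d)) => [||m _].
- exact: deformable0.
- exact: deformableD.
rewrite -scalerAl linearZ /=; apply: deformableZ.
have Xg_homog : 'X_[m] * g \is (mdeg m + e).-homog.
  by apply: dhomogM => //; rewrite dhomogX.
have [<-|deg_neq] := eqVneq (mdeg m + e)%N d; last first.
  by rewrite (pihomog_ne0 deg_neq Xg_homog); apply: deformable0.
by rewrite pihomog_dE //; apply: deformableMX.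
Qed.

Definition deg_lead g m a :=
  g@_m = a /\ forall u, u \in msupp g -> u != m -> deg_neglex_lt u m.

Lemma ideal_lead_lift f m a : I f -> lead f m a -> exists2 g, vanishes g & deg_lead g m a.
Proof.
move=> If /leadP[f_m f_le].
have [g g0 /msize_leP g_low] := ideal_deformable (mdeg m) If.
have g_top u : (mdeg m <= mdeg u)%N -> g@_u = if mdeg u == mdeg m then f@_u else 0.
  by move=> /g_low/eqP; rewrite mcoeffB mcoeff_pihomog subr_eq0 => /eqP.
exists g => //; split=> [|u]; first by rewrite g_top ?eqxx.
case: (ltnP (mdeg u) (mdeg m)) => [lt_deg _ _|/g_top]; first exact: deg_neglex_lt_deg.
rewrite mcoeff_msupp => ->; case: (mdeg u =P mdeg m) => [deg_um|_]; last by rewrite eqxx.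
rewrite -mcoeff_msupp => /f_le/orP[->//|lt_um] _.
exact: deg_neglex_lt_neglex.
Qed.

Context (normal : pred 'X_{1..n}).
Hypothesis nonnormal_divisible : forall m, ~~ normal m ->
  exists g u, [/\ I g, lead g u 1 & mdivides u m].
Hypothesis normal_independent : forall p,
  {in msupp p, forall m, normal m} -> vanishes p -> p = 0.

Definition reducible m p := exists s, [/\ {in msupp s, forall u, normal u},
  {in msupp s, forall u, deg_neglex_lt u m} & vanishes (p - s)].

Lemma reducible_lin m p :
  (forall u, u \in msupp p -> reducible m 'X_[u]) -> reducible m p.
Proof.
move=> X_red; rewrite [p]mpolyE big_seq.
apply: (big_ind (reducible m)) => [|p1 p2|u].
- by exists 0; split=> [u|u|]; rewrite ?msupp0 // subrr; apply: vanishes0.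
- move=> [s1 [normal1 lt1 eq1]] [s2 [normal2 lt2 eq2]].
  exists (s1 + s2); split=> [u /msuppD_le|u /msuppD_le|].
  + by rewrite mem_cat => /orP[/normal1|/normal2].
  + by rewrite mem_cat => /orP[/lt1|/lt2].
  + by rewrite opprD addrACA; apply: vanishesD.
- case/X_red => s [s_normal s_lt eq_s]; exists (p@_u *: s); split=> [w|w|].
  + by move/msuppZ_le/s_normal.
  + by move/msuppZ_le/s_lt.
  + by rewrite -scalerBr; apply: vanishesZ.
Qed.

Lemma reducible_deg_lead_tail g m u (a : F) : deg_lead g u a ->
  (forall w, deg_neglex_lt w u -> reducible m 'X_[w]) -> reducible m (a *: 'X_[u] - g).
Proof.
move=> [g_u g_lt] X_red; apply: reducible_lin => w.
rewrite mcoeff_msupp mcoeffB mcoeffZ mcoeffX; have [<-|ne] := eqVneq u w.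
  by rewrite mulr1 g_u subrr eqxx.
rewrite mulr0 sub0r oppr_eq0 -mcoeff_msupp => w_supp.
by apply/X_red/g_lt => //; rewrite eq_sym.
Qed.

Lemma reducible_mpolyX m u : deg_neglex_lt u m -> reducible m 'X_[u].
Proof.
elim/deg_neglex_ind: u => u IH um; have [u_normal|u_nonnormal] := boolP (normal u).
  exists 'X_[u]; split=> [w|w|]; rewrite ?msuppX ?inE; [by move/eqP->|by move/eqP->|].
  by rewrite subrr; apply: vanishes0.
have [f [w [If lead_f wu]]] := nonnormal_divisible u_nonnormal.
have lead_Xf : lead ('X_[u - w] * f) u 1.
  by have := leadM (leadX _ (u - w)) lead_f; rewrite submK // mulr1.
have [g g0 g_lead] := ideal_lead_lift (in_idealMl _ If) lead_Xf.
have [|s [s_normal s_lt eq_s]] := reducible_deg_lead_tail (m := m) g_lead.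
  by move=> t tu; apply: IH => //; apply: deg_neglex_lt_trans um.
exists s; split=> //; rewrite -['X_[u]](subrK g) -addrA [g - s]addrC addrA.
by apply: vanishesD; rewrite // -[X in X - g]scale1r.
Qed.

Lemma ideal_LM_nonnormal f m : I f -> is_LM f m -> ~~ normal m.
Proof.
move=> If [m_supp m_max]; apply/negP => m_normal.
have lead_f : lead f m f@_m by apply/leadP.
have [g g0 g_lead] := ideal_lead_lift If lead_f.
have [s [s_normal s_lt eq_s]] :=
  reducible_deg_lead_tail g_lead (reducible_mpolyX (m := m)).
have tail0 : f@_m *: 'X_[m] - s = 0.
  apply: normal_independent => [u /msuppB_le|].
    by rewrite mem_cat => /orP[/msuppZ_le|/s_normal //]; rewrite msuppX inE => /eqP->.
  by rewrite -[_ *: _](subrK g) -addrA [g - s]addrC addrA; apply: vanishesD.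
move/(congr1 (mcoeff m)): tail0; rewrite mcoeffB mcoeffZ mcoeffX eqxx mulr1 mcoeff0.
rewrite [s@_m]memN_msupp_eq0 ?subr0; last by apply/negP => /s_lt; rewrite deg_neglex_ltnn.
by move/eqP; rewrite mcoeff_eq0 m_supp.
Qed.

End Deformation.

Section PointConfiguration.
Context (F : fieldType) (n k : nat) (alpha : nat -> F).
Hypothesis alpha_inj : injective alpha.
Implicit Types (v : 'I_n -> F) (p g : {mpoly F[n]}).

Definition point_config v : Prop :=
  staircase k alpha (rev (codom v)) /\ missed k alpha (rev (codom v)) = [::].

Lemma map_meval_mvars v : map (meval v) mvars = codom v.
Proof. by rewrite -map_comp; apply: eq_map => i /=; apply: mevalXU. Qed.

Lemma point_config_take v j : point_config v -> (j <= n)%N ->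
  uniq (take j (codom v)) /\ {subset take j (codom v) <= mkseq alpha (k + j.-1)}.
Proof.
move=> [v_stair _] jn; have := staircase_drop (n - j) v_stair.
rewrite drop_rev size_codom_ord subKn // => take_stair; split.
  by rewrite -rev_uniq; apply: staircase_uniq take_stair.
move=> y; rewrite -mem_rev => /(staircase_sub take_stair).
by rewrite size_rev size_takel ?size_codom_ord.
Qed.

Lemma point_config_sub v : point_config v -> {subset mkseq alpha k <= codom v}.
Proof.
move=> [_ v_missed] y y_in; rewrite -mem_rev; apply: contraT => y_notin.
suff : y \in missed k alpha (rev (codom v)) by rewrite v_missed.
by rewrite mem_filter y_notin.
Qed.

Lemma deformable_hcomp j : (0 < j <= n)%N -> deformable point_config k (hcomp F n k j).
Proof.
move=> /andP[j_gt0 jn]; rewrite (hcompE F (ltnSn k)) //.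
apply: (deformable_coef (a := eseries (mkseq alpha (k + j.-1)))) => [|l l_le|v v_config].
- exact: eseries_coef0.
- by rewrite -hcompE //; apply/dhomog_msize_le/dhomog_hcomp.
have [v_uniq v_sub] := point_config_take v_config jn.
rewrite map_hseries map_take map_meval_mvars eseries_hseries_coef_eq0 //.
  exact: uniq_mkseq_alpha.
by rewrite size_mkseq size_takel ?size_codom_ord //; lia.
Qed.

Lemma deformable_esym r : (n - k < r)%N -> deformable point_config r (Defs.esym F n r).
Proof.
move=> r_gt; have -> : Defs.esym F n r = (-1) ^+ r *: (eseries mvars)`_r.
  by rewrite eseries_mvars_coef scalerA -expr2 sqrr_sign scale1r.
apply: deformableZ.
apply: (deformable_coef (a := hseries r.+1 (mkseq alpha k))) => [|l _|v v_config].
- exact: hseries_coef0.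
- by rewrite eseries_mvars_coef; apply/dhomog_msize_le/dhomogZ/dhomog_mesym.
have [v_uniq _] := point_config_take v_config (leqnn n).
rewrite map_eseries map_meval_mvars mulrC eseries_hseries_coef_eq0 //.
- exact: uniq_mkseq_alpha.
- by rewrite -[codom v]take_size size_codom_ord.
- exact: point_config_sub.
- by rewrite size_mkseq size_codom_ord; lia.
Qed.

Lemma J_gens_deformable g : g \in J_gens F n k ->
  exists2 d, g \is d.-homog & deformable point_config d g.
Proof.
rewrite mem_cat => /orP[] /mapP[j]; rewrite mem_iota => j_range ->.
  by exists k; [exact: dhomog_hcomp|apply: deformable_hcomp; lia].
by exists j; [exact: dhomog_mesym|apply: deformable_esym; lia].
Qed.

Lemma std_mnm_independent p : {in msupp p, forall m, std_mnm k m} ->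
  vanishes point_config p -> p = 0.
Proof.
move=> p_std p0; apply/mpolyP => m; rewrite mcoeff0 -[m]revexpK.
apply: (@std_coef_eq0 F k alpha alpha_inj n 0 (fun e => p@_(mnm_of_seq n e))).
- move=> e size_e e_nonstd; apply/memN_msupp_eq0; apply: contra e_nonstd => /p_std.
  by rewrite /std_mnm mnm_of_seqK.
- move=> ys size_ys ys_stair; rewrite leqn0 size_eq0 => /eqP ys_missed.
  pose v (i : 'I_n) := nth 0 (rev ys) i.
  have vE : rev (codom v) = ys.
    rewrite -[RHS]revK -[rev ys in RHS](mkseq_nth 0) size_rev size_ys.
    by rewrite /mkseq -val_enum_ord -map_comp.
  have := @meval_iter_horner F k n p v; rewrite vE => <-.
    by apply: p0; rewrite /point_config vE.
  by move=> u /p_std/std_ltn; rewrite all_revexp => /forallP.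
- by rewrite size_tuple.
Qed.

End PointConfiguration.

(** * The Groebner basis *)

Section BaseChange.
Context (R K : fieldType) (f : {rmorphism R -> K}) (n : nat).

Lemma map_hcomp d j : map_mpoly f (hcomp R n d j) = hcomp K n d j.
Proof. by rewrite rmorph_sum; apply: eq_bigr => m _; apply: map_mpolyX. Qed.

Lemma map_esym d : map_mpoly f (Defs.esym R n d) = Defs.esym K n d.
Proof.
by rewrite /Defs.esym !mesymE rmorph_sum; apply: eq_bigr => m _; apply: map_mpolyX.
Qed.

Lemma map_in_ideal (P : {mpoly R[n]} -> Prop) (Q : {mpoly K[n]} -> Prop) p :
  (forall g, P g -> Q (map_mpoly f g)) -> in_ideal P p -> in_ideal Q (map_mpoly f p).
Proof.
move=> PQ [s [sP ->]]; rewrite rmorph_sum; apply: in_ideal_sum => y ys.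
by rewrite rmorphM; apply/in_idealMl/in_ideal_gen/PQ/sP.
Qed.

Lemma map_J_gens k g : g \in J_gens R n k -> map_mpoly f g \in J_gens K n k.
Proof.
rewrite !mem_cat => /orP[] /mapP[j j_in ->]; apply/orP; [left|right].
  by rewrite map_hcomp map_f.
by rewrite map_esym map_f.
Qed.

Lemma map_is_LM (p : {mpoly R[n]}) m : is_LM p m -> is_LM (map_mpoly f p) m.
Proof.
have mem_supp := perm_mem (msupp_map_mpoly p (fmorph_inj f)).
by case=> m_supp m_max; split=> [|m']; rewrite mem_supp //; apply: m_max.
Qed.

End BaseChange.

Section Groebner.
Context (R : fieldType) (n k : nat).
Hypothesis k_le : (k <= n)%N.
Local Notation J := (in_ideal_seq (J_gens R n k)).
Implicit Types (m : 'X_{1..n}) (S : {set 'I_n}).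

Lemma lead_demazure_gammaS S : S \in admissible_sets n k ->
  lead (demazure R (mrev (gammaS S))) (mrev (gammaS S)) 1.
Proof.
case/(admissible_setsP _ k_le) => cardS _; rewrite (mrev_gammaS cardS).
by apply: lead_demazure_flag_shape; first exact: gamma_pos_incr.
Qed.

Lemma groebner_list_sub g : g \in groebner_list R n k -> J g.
Proof.
rewrite mem_cat => /orP[g_in|/mapP[S /(admissible_setsP _ k_le)[cardS _] ->]].
  by apply: in_ideal_gen; rewrite mem_cat g_in.
rewrite (mrev_gammaS cardS).
by apply: demazure_flag_shape_in_ideal => //; apply: gamma_pos_incr.
Qed.

Lemma mdivides_mulmU (i : 'I_n) m : mdivides (U_(i) *+ k) m = (k <= m i)%N.
Proof.
apply/mnm_lepP/idP => [/(_ i)|ki j]; rewrite mulmnE mnm1E; first by rewrite eqxx mul1n.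
by case: eqP => [<-|_]; rewrite ?mul1n ?mul0n.
Qed.

Lemma mdivides_gammaS_gt0 S m t : mdivides (mrev (gammaS S)) m -> t \in S ->
  (0 < m (rev_ord t))%N.
Proof.
move=> /mnm_lepP/(_ (rev_ord t)) S_le tS; apply: leq_trans S_le.
by rewrite mrev_gammaS_gt0 rev_ordK.
Qed.

Lemma nonstd_groebner_divisor m : ~~ std_mnm k m ->
  exists g u, [/\ g \in groebner_list R n k, lead g u 1 & mdivides u m].
Proof.
case/nonstd_mdivides => // [[i ki]|[S S_in S_div]].
  exists (hcomp R n k i.+1), (U_(i) *+ k)%MM.
  split; [|exact: lead_hcomp|by rewrite mdivides_mulmU].
  by rewrite mem_cat map_f // mem_iota; apply: (ltn_ord i).
exists (demazure R (mrev (gammaS S))), (mrev (gammaS S)); split=> //.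
  by rewrite mem_cat [X in _ || X]map_f ?orbT.
exact: lead_demazure_gammaS.
Qed.

Lemma groebner_listP g : g \in groebner_list R n k ->
  (exists2 i : 'I_n, g = hcomp R n k i.+1 & lead g (U_(i) *+ k)%MM 1) \/
  (exists S, [/\ S \in admissible_sets n k, g = demazure R (mrev (gammaS S)) &
     lead g (mrev (gammaS S)) 1]).
Proof.
rewrite mem_cat => /orP[] /mapP[].
  case=> [|i]; rewrite mem_iota // => i_range ->; left.
  have i_lt : (i < n)%N by case/andP: i_range.
  by exists (Ordinal i_lt) => //; apply: (lead_hcomp R k (Ordinal i_lt)).
by move=> S S_in ->; right; exists S; split=> //; apply: lead_demazure_gammaS.
Qed.

Lemma groebner_list_lead g : g \in groebner_list R n k -> exists u, lead g u 1.
Proof.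
by case/groebner_listP => [[i _ g_lead]|[S [_ _ g_lead]]]; eexists; exact: g_lead.
Qed.

Lemma groebner_list_mdivides_inj g g' u u' : (0 < k < n)%N ->
  g \in groebner_list R n k -> g' \in groebner_list R n k ->
  is_LM g u -> is_LM g' u' -> mdivides u u' -> g = g'.
Proof.
move=> /andP[k_gt0 k_lt] g_in g'_in /is_LM_inj uE /is_LM_inj u'E.
case/groebner_listP: g_in => [[i gE g_lead]|[S [S_in gE g_lead]]];
case/groebner_listP: g'_in => [[i' g'E g'_lead]|[S' [S'_in g'E g'_lead]]];
rewrite (uE _ (lead_is_LM g_lead)) (u'E _ (lead_is_LM g'_lead)) => uu'.
- move: uu'; rewrite mdivides_mulmU mulmnE mnm1E gE g'E.
  by case: (i' =P i) => [-> //|_]; rewrite leqNgt k_gt0.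
- have [cardS' S'_lt] := admissible_setsP _ k_le S'_in.
  by move: uu'; rewrite mdivides_mulmU leqNgt (mrev_gammaS_ltn _ k_gt0 cardS').
- have [cardS _] := admissible_setsP _ k_le S_in.
  have /card_gt1P[s [t [sS tS]]] : (1 < #|S|)%N by lia.
  have S_single r : r \in S -> r = rev_ord i'.
    move/(mdivides_gammaS_gt0 uu'); rewrite mulmnE mnm1E.
    by case: (i' =P rev_ord r) => [->|_]; rewrite ?rev_ordK.
  by rewrite (S_single s sS) (S_single t tS) eqxx.
- have [[cardS _] [cardS' _]] :=
    (admissible_setsP _ k_le S_in, admissible_setsP _ k_le S'_in).
  have SS' : S \subset S'.
    apply/subsetP => t /(mdivides_gammaS_gt0 uu').
    by rewrite mrev_gammaS_gt0 rev_ordK.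
  rewrite gE g'E; congr (demazure R (mrev (gammaS _))); apply/eqP.
  by rewrite eqEcard SS'; lia.
Qed.

End Groebner.

(* Passing to F(t), where the powers of t are distinct scalars. *)
Lemma J_LM_nonstd (R : fieldType) (n k : nat) (f : {mpoly R[n]}) m :
  (k <= n)%N -> in_ideal_seq (J_gens R n k) f -> is_LM f m ->
  ~~ std_mnm k m.
Proof.
move=> k_le Jf m_LM.
pose K : fieldType := {fraction {poly R}}.
pose embed : {rmorphism R -> K} := @tofrac {poly R} \o polyC.
pose alpha (i : nat) : K := tofrac ('X^i).
have alpha_inj : injective alpha.
  move=> i j /eqP; rewrite tofrac_eq => /eqP/(congr1 (fun p : {poly R} => size p)).
  by rewrite !size_polyXn => -[].
apply: (ideal_LM_nonnormal (J_gens_deformable alpha_inj) _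
  (std_mnm_independent alpha_inj)
  (map_in_ideal (@map_J_gens _ _ embed n k) Jf) (map_is_LM embed m_LM)).
move=> u /(@nonstd_groebner_divisor K n k k_le)[g [w [g_in g_lead wu]]].
by exists g, w; split=> //; apply: groebner_list_sub g_in.
Qed.

Lemma groebner_list_is_groebner (R : fieldType) (n k : nat) :
  (k <= n)%N ->
  is_groebner (in_ideal_seq (J_gens R n k)) (groebner_list R n k).
Proof.
move=> k_le; split=> [g|p]; first exact: groebner_list_sub.
split; apply: in_ideal_sub => q [f [m [f_in [f_neq0 [m_LM ->]]]]].
  have := J_LM_nonstd k_le f_in m_LM.
  case/(nonstd_groebner_divisor R k_le) => g [u [g_in g_lead um]].
  rewrite -(submK um) mpolyXD; apply/in_idealMl/in_ideal_gen.
  exists g, u; split=> //; split; first exact: lead_neq0 g_lead.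
  by split=> //; apply: lead_is_LM.
apply: in_ideal_gen; exists f, m; split; last by [].
exact: groebner_list_sub f_in.
Qed.

Theorem mainTheorem6 (R : fieldType) (n k : nat) :
  (0 < k)%N -> (k <= n)%N ->
  is_groebner (in_ideal_seq (J_gens R n k)) (groebner_list R n k) /\
  ((k < n)%N -> is_minimal_groebner (in_ideal_seq (J_gens R n k)) (groebner_list R n k)).
Proof.
move=> k_gt0 k_le; have gb := groebner_list_is_groebner R k_le; split=> // k_lt.
split=> //; split=> [g g_in|g g' m m' g_in g'_in gg' m_LM m'_LM].
  have [u g_lead] := groebner_list_lead k_le g_in; split; first exact: lead_neq0 g_lead.
  move=> m m_LM; rewrite (is_LM_inj m_LM (lead_is_LM g_lead)).
  by have /leadP[] := g_lead.
apply: contraNN gg' => mm'; apply/eqP.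
have k_range : (0 < k < n)%N by rewrite k_gt0.
exact: (groebner_list_mdivides_inj k_le k_range g_in g'_in m_LM m'_LM mm').
Qed.
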